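(* For $n\ge1$ let $p_n(x)\in\mathbb{Q}[x]$ be the polynomial $$p_n(x)=\sum_{k=1}^n(-1)^{k-1}\frac{(k-1)!}{(n-1)!}\,S(n,k)\,x^k,$$ where $S(n,k)$ are the Stirling numbers of the second kind. (1) We have $p_1(x)=x$, $p_2(x)=x(1-x)$, and $p_n(1-x)=(-1)^np_n(x)$ for $n\ge2$. (2) For $n\ge1$, $p_n(x)$ has $n$ simple zeroes $x^{[n]}_1<\dots<x^{[n]}_n$ in the interval $[0,1]$, with $x^{[n]}_1=0$, with $x^{[n]}_n=1$ if $n\ge2$, and with $x^{[n]}_j<x^{[n+1]}_{j+1}<x^{[n]}_{j+1}$ for $j=1,\dots,n-1$. Thus the zeroes of $p_n$ and of $p_{n+1}$ are interlaced. (3) The distribution of the zeroes $x\in(0,1)$ of $p_n$ for large $n$ is governed by the density function $\rho:(0,1)\to\mathbb{R}$, $$\rho(x)=\frac{1}{x(1-x)\,|y_0|^2},\qquad y_0=\operatorname{Re}\left(\log(x-1)-\log x\right)+i\pi,$$ that is, for all $0<a<b<1$, $\lim_{n\to\infty}\frac1n\#\{x\in[a,b]\mid p_n(x)=0\}=\int_a^b\rho(x)\,dx$. (4) For $x\in(0,1)$ and $n\ge2$, with $y_0$ as in (3), $$p_n(x)=\frac{-1}{(2\pi i)^n}\left\{\zeta\left(n,\frac{y_0}{2\pi i}\right)+(-1)^n\zeta\left(n,1-\frac{y_0}{2\pi i}\right)\right\},$$ where $\zeta(n,a)$ is the Hurwitz zeta function.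
   Context: The Hurwitz zeta function is $\zeta(n,a)=\sum_{j=0}^\infty(j+a)^{-n}$ for integers $n\ge2$ and $a\in\mathbb{C}\setminus\{0,-1,-2,\dots\}$. For $x\in(0,1)$, $\operatorname{Re}(\log(x-1)-\log x)=\ln\frac{1-x}{x}$. *)

(* Defs.v *)
From HB Require Import structures.
From mathcomp Require Import all_boot all_order all_algebra.
From mathcomp Require Import complex.
From mathcomp Require Import all_classical all_reals all_analysis.

Set Implicit Arguments.
Unset Strict Implicit.
Unset Printing Implicit Defensive.

Import Order.TTheory GRing.Theory Num.Theory.
Import numFieldNormedType.Exports.

Local Open Scope ring_scope.
Local Open Scope complex_scope.

(* S(n, k): the number of partitions of an n-element set into k nonempty
   blocks ([finset.partition] excludes empty blocks). *)
Definition stirling2 (n k : nat) : nat :=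
  #|[pred P : {set {set 'I_n}} |
      finset.partition P [set: 'I_n]%SET && (#|P| == k)]|.

(* Only meaningful for n >= 1. *)
Definition p_ (n : nat) : {poly rat} :=
  \sum_(1 <= k < n.+1)
    ((-1) ^+ k.-1 * ((k.-1)`!%:R / (n.-1)`!%:R) * (stirling2 n k)%:R) *: 'X^k.

Definition p_real (R : realType) (n : nat) : {poly R} := map_poly ratr (p_ n).

(* Principal argument, in ]-pi, pi], and principal logarithm; both take junk
   values at 0. *)
Definition carg (R : realType) (z : R[i]) : R :=
  let t := acos (complex.Re z / Normc.normc z) in
  if 0 <= complex.Im z then t else - t.

Definition clog (R : realType) (z : R[i]) : R[i] :=
  ln (Normc.normc z) +i* carg z.

(* Meant for 0 < x < 1, where Re (clog (x - 1) - clog x) = ln ((1 - x) / x). *)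
Definition y0 (R : realType) (x : R) : R[i] :=
  complex.Re (clog (x%:C - 1) - clog x%:C) +i* pi.

Definition rho (R : realType) (x : R) : R :=
  (x * (1 - x) * Normc.normc (y0 x) ^+ 2)^-1.

Definition two_pi_i (R : realType) : R[i] := 0 +i* (2 * pi).

(* [R[i]^o] carries the usual topology of the complex plane. Meant for
   n >= 2 and a outside {0, -1, -2, ...}, where the series converges. *)
Definition hurwitz_zeta (R : realType) (n : nat) (a : R[i]) : R[i] :=
  limn (series (fun j : nat => (j%:R + a) ^- n : R[i]^o)).

(* Main.v *)
Require Import Defs.
From mathcomp Require Import all_boot all_order all_algebra.
From mathcomp Require Import complex finmap.
From mathcomp Require Import all_classical all_reals all_analysis.
From mathcomp Require Import ring lra zify.
From mathcomp Require polyrcf.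

(** In the variable [y = t + i pi] with [x = 1 / (1 - exp y) = 1 / (1 + exp t)],
    one has [dx / dt = - x (1 - x)], and the recurrence
    [S (n + 1, k) = k S (n, k) + S (n, k - 1)] of the Stirling numbers says that
    [p_(n + 1) = x (1 - x) p_n' / n] ([p_S]); so [p_n] is, up to a constant, an
    iterated derivative of the Fermi function [1 / (1 + exp t)].

    The symmetry ([p_sym]) is immediate by induction. For the zeros, Rolle's
    theorem gives a zero of [p_n'] between consecutive zeros of [p_n], and the
    factor [x (1 - x)] adds the zeros [0] and [1]; counting degrees, all zeros
    are simple and interlace ([zero_list_step], [mup_zeros]).

    The Hurwitz zeta formula is the partial fraction expansion
    [p_n = - sum over k in Z of (y + 2 pi i k) ^ (- n)], whose halves [k >= 0] and
    [k < 0] give the two zeta values ([hurwitz_expansion]). It is obtained without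
    termwise differentiation. The function [Phi n y = p_n (1 / (1 - exp y))] of
    the complex variable [y] satisfies the duplication formula
    [2 ^ n Phi n y = Phi n (y / 2) + Phi n (y / 2 + i pi)], a polynomial identity in
    [exp (y / 2)] proved by differentiating it ([eulerian_dup]). Iterating it [m]
    times writes [Phi n y] as [2 ^ (- n m)] times the sum of the values of [Phi n]
    at [2 ^ m] points of the form [(y + 2 pi i k) / 2 ^ m]. As
    [s ^ n Phi n s = - 1 + O (s)] near [0] ([Phi_leading]), uniformly on the strip
    that contains these points, each of them contributes
    [- (y + 2 pi i k) ^ (- n)] up to an error, and the total error tends to [0]
    ([Phi_expansion]).

    For the distribution of the zeros, only the two poles nearest to [y] matter
    when [n] is large and [t] stays bounded, so [p_n] is close to
    [- 2 cos (n phi) / |y| ^ n], where [phi] is the argument of [y = y0 x]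
    ([p_real_sign]). Hence [p_n] changes sign between consecutive points with
    [phi = j pi / n]. This yields at least [n (cdf b - cdf a) - 3] zeros in
    [(a, b)], with [cdf = phi / pi] ([zeros_between]); since there are only [n]
    zeros in total, the same lower bound on two intervals that fill the rest of
    [(0, 1)] gives the matching upper bound ([zeros_equidistributed]). Finally
    [rho] is the derivative of [cdf] ([integral_rho]). *)

Set Implicit Arguments.
Unset Strict Implicit.
Unset Printing Implicit Defensive.

Import Order.TTheory GRing.Theory Num.Theory.
Import numFieldNormedType.Exports.

Local Open Scope ring_scope.

(** * Stirling numbers of the second kind *)

Fixpoint stirling_rec (n k : nat) : nat :=
  match n, k with
  | 0, 0 => 1
  | 0, _.+1 => 0
  | _.+1, 0 => 0
  | n'.+1, k'.+1 => (k'.+1 * stirling_rec n' k'.+1 + stirling_rec n' k')%N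
  end.

Section CountPartitions.
Import fintype finset.
Variable T : finType.
Implicit Types (D B : {set T}) (P Q : {set {set T}}).

Definition parts D k : {set {set {set T}}} :=
  [set P | finset.partition P D && (#|P| == k)].

Lemma notin_partition D P B x : finset.partition P D -> x \notin D ->
  x \in B -> B \notin P.
Proof.
move=> pP xD xB; apply: contra xD => BP.
exact: (subsetP (partitionS pP BP)).
Qed.

Lemma mem_parts D k P :
  (P \in parts D k) = finset.partition P D && (#|P| == k).
Proof. by rewrite inE. Qed.

Let partsE := (mem_parts, inE).

(** Removing the block [{x}] leaves a partition of [D]. *)
Lemma card_parts_singleton D x k : x \notin D ->
  #|[set P in parts (x |: D) k.+1 | [set x]%SET \in P]| = #|parts D k|.
Proof.
move=> xD.
rewrite -(@card_in_imset _ _ (fun Q : {set {set T}} => [set x]%SET |: Q)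
  (parts D k)).
  congr (#|pred_of_set _|); apply/finset.setP => P; apply/idP/imsetP.
    rewrite !partsE => /andP[/andP[pP /eqP cP] xP].
    exists (P :\ [set x]%SET); last by rewrite finset.setD1K.
    rewrite partsE; have := partitionD1 pP xP; rewrite finset.setU1K // => -> /=.
    by move: cP; rewrite (cardsD1 [set x]%SET P) xP add1n => -[->].
  case=> Q; rewrite mem_parts => /andP[pQ /eqP cQ] ->.
  rewrite !partsE eqxx orTb andbT.
  have xQ : [set x]%SET \notin Q by apply: (notin_partition pQ xD); rewrite partsE.
  rewrite cardsU1 xQ cQ eqxx andbT; apply: partitionU1 => //.
    by apply/finset.set0Pn; exists x; rewrite partsE.
  by rewrite disjoints1.
move=> P Q; rewrite !partsE => /andP[pP _] /andP[pQ _] e.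
have xP : [set x]%SET \notin P by apply: (notin_partition pP xD); rewrite partsE.
have xQ : [set x]%SET \notin Q by apply: (notin_partition pQ xD); rewrite partsE.
by rewrite -(finset.setU1K xP) -(finset.setU1K xQ) e.
Qed.

(** If [{x}] is not a block, removing [x] from its block leaves a partition of
    [D] with a marked block; conversely, [x] can be inserted into each of the [k]
    blocks of a partition of [D]. *)
Lemma card_parts_block D x k : x \notin D ->
  #|[set P in parts (x |: D) k | [set x]%SET \notin P]| =
  (k * #|parts D k|)%N.
Proof.
move=> xD.
pose W := [set QC : {set {set T}} * {set T} |
            (QC.1 \in parts D k) && (QC.2 \in QC.1)].
have cW : #|W| = (k * #|parts D k|)%N.
  rewrite -sum1_card (eq_bigl (fun QC => (QC.1 \in parts D k) &&
     (QC.2 \in QC.1))); last by move=> QC; rewrite partsE.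
  rewrite -(pair_big_dep (fun Q => Q \in parts D k) (fun Q C => C \in Q)
     (fun _ _ => 1%N)) /=.
  rewrite (eq_bigr (fun=> k)) ?sum_nat_const 1?mulnC // => Q.
  by rewrite partsE => /andP[_ /eqP cQ]; rewrite sum1_card.
(* [g] inserts [x] into the marked block. *)
pose g (QC : {set {set T}} * {set T}) := (x |: QC.2) |: (QC.1 :\ QC.2).
rewrite -cW -(@card_in_imset _ _ g W).
  congr (#|pred_of_set _|); apply/finset.setP => P; apply/idP/imsetP.
    rewrite !partsE => /andP[/andP[pP /eqP cP] xP].
    have xcov : x \in finset.cover P by rewrite (cover_partition pP) !partsE eqxx.
    set B := finset.pblock P x.
    have BP : B \in P by rewrite pblock_mem.
    have xB : x \in B by rewrite mem_pblock.
    have BnP : B :\ x \notin P.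
      apply/negP => BxP; have [_ tP] := and3P pP.
      move=> P0; have /finset.trivIsetP tt := tP.
      have BBx : B != B :\ x.
        by apply/negP => /eqP e; move: xB; rewrite e !partsE eqxx.
      have := tt _ _ BP BxP BBx; rewrite -setI_eq0 => /eqP e0.
      have : B :\ x = finset.set0.
        apply/eqP; rewrite -finset.subset0 -e0 finset.subsetI subxx andbT.
        exact: subD1set.
      by move=> e1; move: P0; rewrite -e1 BxP.
    exists ((B :\ x) |: (P :\ B), B :\ x); last first.
      rewrite /g /= finset.setU1K; last by rewrite !partsE (negPf BnP) andbF.
      by rewrite !finset.setD1K.
    rewrite !partsE /= eqxx /= !andbT.
    have BD : B \subset x |: D := partitionS pP BP.
    apply/andP; split; last first.
      rewrite cardsU1 !partsE (negPf BnP) andbF /=.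
      by rewrite -cP (cardsD1 B P) BP.
    have -> : D = (B :\ x) :|: ((x |: D) :\: B).
      apply/finset.setP => z; rewrite !partsE.
      have [-> | zx] := eqVneq z x; first by rewrite xB (negPf xD).
      have /subsetP/(_ z) := BD; rewrite !partsE (negPf zx) /=.
      by case: (z \in B) => //= ->.
    apply: partitionU1; first exact: partitionD1.
      apply: contra xP => /eqP e0; suff -> : [set x]%SET = B by [].
      by rewrite -(finset.setD1K xB) e0 finset.setU0.
    rewrite -setI_eq0; apply/eqP/finset.setP => z; rewrite !partsE.
    by case: (z \in B); rewrite ?andbF.
  case=> -[Q C]; rewrite !partsE /= => /andP[/andP[pQ /eqP cQ] CQ] ->.
  have xCQ : x |: C \notin Q :\ C.
    rewrite !partsE negb_and; apply/orP; right.
    by apply: (notin_partition pQ xD); rewrite !partsE eqxx.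
  have CD := partitionS pQ CQ.
  have xC : x \notin C by apply: contra xD; apply: (subsetP CD).
  rewrite /g /= cardsU1 xCQ -cQ (cardsD1 C Q) CQ eqxx andbT.
  apply/andP; split.
    have -> : x |: D = (x |: C) :|: (D :\: C).
      apply/finset.setP => z; rewrite !partsE.
      by have /subsetP/(_ z) := CD; case: (z \in C) => [->|] //; rewrite ?orbT ?orbF.
    apply: partitionU1; first exact: partitionD1.
      by apply/finset.set0Pn; exists x; rewrite !partsE eqxx.
    rewrite -setI_eq0; apply/eqP/finset.setP => z; rewrite !partsE.
    have [-> | zx] := eqVneq z x; first by rewrite (negPf xD) andbF.
    by case: (z \in C).
  rewrite !partsE negb_or; apply/andP; split.
    have /finset.set0Pn [z zC] : C != finset.set0.
      by have /and3P[_ _ Q0] := pQ; apply: contra Q0 => /eqP <-.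
    apply/negP => /eqP/finset.setP/(_ z); rewrite !partsE zC orbT => /eqP zx.
    by move: xC; rewrite -zx zC.
  rewrite negb_and; apply/orP; right.
  by apply: (notin_partition pQ xD); rewrite partsE.
have gE Q C : (Q, C) \in W -> C = finset.pblock (g (Q, C)) x :\ x /\
    Q = C |: (g (Q, C) :\ (x |: C)).
  rewrite !partsE /= => /andP[/andP[pQ /eqP cQ] CQ].
  have xCQ : x |: C \notin Q :\ C.
    rewrite !partsE negb_and; apply/orP; right.
    by apply: (notin_partition pQ xD); rewrite !partsE eqxx.
  have CD := partitionS pQ CQ.
  have xC : x \notin C by apply: contra xD; apply: (subsetP CD).
  split; last by rewrite /g /= finset.setU1K // finset.setD1K.
  suff -> : finset.pblock (g (Q, C)) x = x |: C by rewrite finset.setU1K.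
  have tg : finset.trivIset (g (Q, C)).
    apply/finset.trivIsetP => A A'; rewrite !partsE.
    have /and3P[_ /finset.trivIsetP tQ _] := pQ.
    have dj E : E != C -> E \in Q -> [disjoint x |: C & E].
      move=> EC EQ; rewrite -setI_eq0 finset.setIUl
         finset.setU_eq0 setI_eq0 disjoints1 setI_eq0 (tQ C) 1?eq_sym // andbT.
      by apply: contra xD; apply: (subsetP (partitionS pQ EQ)).
    case/orP => [/eqP -> | /andP[AC AQ]]; case/orP => [/eqP -> | /andP[A'C A'Q]].
    - by rewrite eqxx.
    - by move=> _; apply: dj.
    - by move=> _; rewrite disjoint_sym; apply: dj.
    - by move=> AA'; apply: tQ.
  by apply: def_pblock => //; rewrite ?partsE ?eqxx.
move=> [Q C] [Q' C'] W1 W2 e.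
have [C1 Q1] := gE _ _ W1; have [C2 Q2] := gE _ _ W2.
have eC : C = C' by apply: (etrans C1); rewrite e -C2.
by congr pair => //; apply: (etrans Q1); rewrite e eC -Q2.
Qed.

(** Partitions of arbitrary finite sets are counted so that the induction can
    remove an element. *)
Lemma card_parts D k : #|parts D k| = stirling_rec #|D| k.
Proof.
move: {2}#|D| (erefl #|D|) => n; elim: n => [|n IHn] in D k *.
  move=> /eqP; rewrite cards_eq0 => /eqP ->; rewrite cards0.
  have -> : parts finset.set0 k = if k is 0 then [set finset.set0]%SET
    else finset.set0.
    apply/finset.setP => P; rewrite inE partition_set0.
    by case: k => [|k]; rewrite !inE; case: eqVneq => //= ->; rewrite cards0.
  by case: k => [|k]; rewrite ?cards1 ?cards0.
move=> cD; have [x xD] : exists x, x \in D.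
  by apply/finset.set0Pn; rewrite -cards_eq0 cD.
pose D' := D :\ x; have xD' : x \notin D' by rewrite !inE eqxx.
have eD : D = x |: D' by rewrite finset.setD1K.
have cD' : #|D'| = n by move: cD; rewrite eD cardsU1 xD' => -[].
rewrite cD {1}eD; case: k => [|k].
  apply/eqP; rewrite cards_eq0; apply/eqP/finset.setP => P; rewrite !inE.
  apply/negP => /andP[pP /eqP/eqP]; rewrite cards_eq0 => /eqP P0.
  have := cover_partition pP; rewrite P0 /finset.cover finset.big_set0.
  by move=> /finset.setP/(_ x); rewrite !inE eqxx.
rewrite /= -cD' -IHn // -IHn // -(card_parts_block _ xD').
rewrite -(card_parts_singleton _ xD') addnC.
rewrite -(cardsID [set P : {set {set T}} | [set x]%SET \in P]
  (parts (x |: D') k.+1)).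
congr (_ + _)%N; apply: eq_card => P; rewrite !inE; first by [].
by rewrite andbC.
Qed.

End CountPartitions.

Lemma stirling2E n k : stirling2 n k = stirling_rec n k.
Proof.
rewrite -[n in RHS]card_ord -cardsT -card_parts /stirling2 /parts.
by apply: eq_card => P; rewrite !inE.
Qed.

Local Open Scope classical_set_scope.
Local Open Scope ring_scope.
Local Open Scope complex_scope.

(** * The differential recurrence and the symmetry *)

Lemma stirling_rec_small n k : (n < k)%N -> stirling_rec n k = 0%N.
Proof.
elim: n k => [|n IHn] [|k] //= nk.
by rewrite !IHn ?muln0 // ltnW.
Qed.

Lemma stirling_recn0 n : (0 < n)%N -> stirling_rec n 0 = 0%N.
Proof. by case: n. Qed.

Lemma stirling_recnn n : stirling_rec n n = 1%N.
Proof. by elim: n => //= n ->; rewrite stirling_rec_small ?muln0. Qed.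

Lemma coef_p_ n k : (0 < n)%N ->
  (p_ n)`_k = (-1) ^+ k.-1 * (k.-1`!%:R / n.-1`!%:R) * (stirling_rec n k)%:R.
Proof.
move=> n0; rewrite /p_ coef_sum.
under eq_bigr do rewrite coefZ coefXn stirling2E.
case: k => [|k].
  rewrite stirling_recn0 // mulr0 big_nat big1 // => i /andP[i0 _].
  by rewrite eq_sym gtn_eqF ?mulr0.
have [kn|nk] := ltnP k n; last first.
  rewrite stirling_rec_small // mulr0 big_nat big1 // => i /andP[_ i0].
  by rewrite gtn_eqF ?mulr0 // (leq_trans i0).
rewrite (@bigD1_seq _ _ _ _ _ k.+1) ?iota_uniq ?mem_index_iota //=.
rewrite eqxx mulr1 big1 ?addr0 // => i ik.
by rewrite eq_sym (negPf ik) mulr0.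
Qed.

(** Multiplying the [k]-th coefficient by [k] amounts to applying [x d/dx], so the
    recurrence of the Stirling numbers becomes a differential one. *)
Lemma p_S n : (0 < n)%N ->
  p_ n.+1 = n%:R^-1 *: ('X * (1 - 'X) * (p_ n)^`()).
Proof.
move=> n0; have nz : (n%:R : rat) != 0 by rewrite pnatr_eq0 -lt0n.
have fz m : (m`!%:R : rat) != 0 by rewrite pnatr_eq0 -lt0n fact_gt0.
have fn : n`!%:R = n%:R * n.-1`!%:R :> rat.
  by rewrite -natrM -[in RHS](prednK n0) -factS prednK.
apply/polyP => k; rewrite coef_p_ // coefZ mulrBr mulr1 mulrBl coefB.
rewrite -!mulrA !coefXM /= fn invfM; case: k => [|[|k]] /=.
- by rewrite subr0 !mulr0.
- rewrite coef_deriv coef_p_ //= !fact0 expr0 /= subr0 stirling_recn0 //.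
  rewrite mul1n addn0.
  by move: (fz n.-1) nz; set a := n.-1`!%:R => az nz; field; rewrite az nz.
rewrite !coef_deriv -[_`_ _ *+ k.+2]mulr_natr -[_`_ _ *+ k.+1]mulr_natr.
rewrite !coef_p_ //= [k.+1`!]factS exprS natrD !natrM.
move: (fz n.-1) nz; set a := n.-1`!%:R => az nz; field.
by rewrite az nz.
Qed.

Lemma p_1 : p_ 1 = 'X.
Proof.
apply/polyP => k; rewrite coef_p_ // coefX.
case: k => [|[|k]]; rewrite ?mulr0 //; last by rewrite stirling_rec_small ?mulr0.
Qed.

Lemma p_2 : p_ 2 = 'X * (1 - 'X).
Proof. by rewrite p_S // p_1 derivX mulr1 invr1 scale1r. Qed.

(** The substitution [x -> 1 - x] fixes the factor [x (1 - x)] of the recurrence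
    and changes the sign of the derivation. *)
Lemma p_sym n : (2 <= n)%N -> p_ n \Po (1 - 'X) = (-1) ^+ n *: p_ n.
Proof.
case: n => [|[|n]] // _; elim: n => [|n IHn].
  rewrite p_2 comp_polyM comp_polyB comp_polyX comp_polyC sqrrN expr1n scale1r.
  by rewrite subKr mulrC.
rewrite p_S // comp_polyZ !comp_polyM comp_polyB comp_polyX comp_polyC.
have -> : (p_ n.+2)^`() \Po (1 - 'X) = - ((-1) ^+ n.+2 *: (p_ n.+2)^`()).
  rewrite -derivZ -IHn deriv_comp derivB derivC derivX sub0r mulrN1 opprK.
  by [].
rewrite subKr ['X * _ in RHS]mulrC mulrN -scalerAr -scaleN1r !scalerA.
by congr (_ *: _); rewrite -mulrA -exprS mulrC.
Qed.

Section RealP.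
Variable R : realType.
Local Notation P n := (p_real R n).

Lemma coef_p_real n k : (0 < n)%N ->
  (P n)`_k = (-1) ^+ k.-1 * (k.-1`!%:R / n.-1`!%:R) * (stirling_rec n k)%:R.
Proof.
move=> n0; rewrite coef_map coef_p_ //= !rmorphM fmorphV rmorphXn rmorphN1.
by rewrite !rmorph_nat.
Qed.

Lemma p_real_S n : (0 < n)%N ->
  P n.+1 = n%:R^-1 *: ('X * (1 - 'X) * (P n)^`()).
Proof.
move=> n0; rewrite /p_real p_S // map_polyZ /= fmorphV rmorph_nat.
by rewrite !rmorphM rmorphB rmorph1 /= map_polyX deriv_map.
Qed.

Lemma p_real_1 : P 1 = 'X.
Proof. by rewrite /p_real p_1 map_polyX. Qed.

Lemma lead_p_real n : (0 < n)%N -> (P n)`_n = (-1) ^+ n.-1.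
Proof.
move=> n0; by rewrite coef_p_real // stirling_recnn mulr1 divff ?mulr1.
Qed.

Lemma size_p_real n : (0 < n)%N -> size (P n) = n.+1.
Proof.
move=> n0; apply/eqP; rewrite eqn_leq; apply/andP; split.
  apply/leq_sizeP => k nk; rewrite coef_p_real // stirling_rec_small //.
  by rewrite mulr0.
rewrite ltnNge; apply/negP => /leq_sizeP/(_ n (leqnn n)); rewrite lead_p_real //.
by apply/eqP; rewrite signr_eq0.
Qed.

Lemma p_real_neq0 n : (0 < n)%N -> P n != 0.
Proof. by move=> n0; rewrite -size_poly_eq0 size_p_real. Qed.

End RealP.

(** * Zeros and interlacing *)

Section Zeros.
Variable R : realType.
Local Notation P n := (p_real R n).

(** The zeros are numbered from [1] to [n]; the other values of [f] are
    arbitrary. *)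
Definition zero_list n (f : nat -> R) : Prop :=
  [/\ forall j, (1 <= j <= n)%N -> root (P n) (f j),
      forall j k, (1 <= j)%N -> (j < k)%N -> (k <= n)%N -> f j < f k,
      f 1%N = 0 & (2 <= n)%N -> f n = 1].

Definition interlace n (f g : nat -> R) : Prop :=
  forall j, (1 <= j <= n.-1)%N -> f j < g j.+1 < f j.+1.

Lemma zero_list_ge0 n f j : zero_list n f -> (1 <= j <= n)%N -> 0 <= f j.
Proof.
case=> _ inc f1 _ /andP[j1 jn]; rewrite -f1.
by move: j1; rewrite leq_eqVlt => /orP[/eqP <- //|j1]; rewrite ltW // inc.
Qed.

Lemma zero_list_le1 n f j : zero_list n f -> (1 <= j <= n)%N -> f j <= 1.
Proof.
case=> _ inc f1 fn /andP[j1 jn].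
have [n1|n2] := ltnP 1 n; last first.
  have e1 : j = 1%N by lia.
  by rewrite e1 f1 ler01.
rewrite -(fn n1); move: jn; rewrite leq_eqVlt => /orP[/eqP -> //|jn].
by rewrite ltW // inc.
Qed.

(** Rolle's theorem places a zero of the derivative strictly between two
    consecutive zeros, and the factor x (1 - x) of the differential recurrence
    supplies the two endpoints. *)
Lemma zero_list_step n f : (0 < n)%N -> zero_list n f ->
  exists2 g, zero_list n.+1 g & interlace n f g.
Proof.
move=> n0 zf; have [rf inc f1 fn] := zf.
have rolle j : exists c, (1 <= j <= n.-1)%N ->
    f j < c < f j.+1 /\ (P n)^`().[c] = 0.
  case: (boolP (1 <= j <= n.-1)%N) => [jn|_]; last by exists 0.
  have ff : f j < f j.+1 by apply: inc; lia.
  have [|c cin c0] := @polyrcf.poly_rolle R _ _ (P n) ff.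
    have /eqP -> := rf j ltac:(lia); have /eqP -> := rf j.+1 ltac:(lia).
    by [].
  by exists c => _; split => //; rewrite in_itv /= in cin.
have [c cP] := choice rolle.
pose g j := if j == 1%N then 0 else if j == n.+1 then 1 else c j.-1.
have gc j : (1 <= j <= n.-1)%N -> g j.+1 = c j.
  by move=> jn; rewrite /g /= !ifF //; lia.
exists g; last by move=> j jn; rewrite gc //; have [] := cP _ jn.
have g1 : g 1%N = 0 by [].
have gn : g n.+1 = 1 by rewrite /g ifF ?eqxx //; lia.
split => //.
- move=> j jn; rewrite p_real_S // rootZ ?invr_eq0 ?pnatr_eq0 -?lt0n //.
  rewrite rootE !hornerM hornerX !hornerE /=.
  rewrite /g; case: (eqVneq j 1%N) => [_|j1]; first by rewrite !mul0r.
  case: (eqVneq j n.+1) => [_|jn1]; first by rewrite subrr mulr0 mul0r.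
  by have [|_ ->] := cP j.-1; [lia | rewrite mulr0].
- move=> j k j1 jk kn.
  have gj : (j <= n)%N -> (j == 1%N) || (g j < f j).
    move=> jn; case: eqVneq => //= j1'; have [|/andP[_]] := cP j.-1; first lia.
    by rewrite -gc ?prednK //; lia.
  have gk : (2 <= k)%N -> (k == n.+1) || (f k.-1 < g k).
    move=> k2; case: eqVneq => //= kn'; have [|/andP[h _] _] := cP k.-1.
      lia.
    by move: h; rewrite -gc ?prednK //; lia.
  have fjk : (j < k.-1)%N -> f j < f k.-1 by move=> ?; apply: inc; lia.
  have fjk' : (j <= k.-1)%N -> f j <= f k.-1.
    by rewrite leq_eqVlt => /orP[/eqP -> //|/fjk/ltW].
  have fj0 := @zero_list_ge0 n f.
  have fj1 := @zero_list_le1 n f.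
  have /orP[/eqP ej|hj] := gj ltac:(lia).
    rewrite ej g1; have /orP[/eqP ek|hk] := gk ltac:(lia).
      by rewrite ek gn ltr01.
    by apply: le_lt_trans hk; apply: fj0 => //; lia.
  apply: (lt_le_trans hj); have /orP[/eqP ek|hk] := gk ltac:(lia).
    by rewrite ek gn; apply: fj1 => //; lia.
  by apply: le_trans (ltW hk); apply: fjk'; lia.
Qed.

Lemma zero_list1 : zero_list 1 (fun=> 0).
Proof.
split => //; last by move=> j k *; lia.
by move=> j _; rewrite p_real_1 rootX.
Qed.

Lemma zero_list_exists : exists xi : nat -> nat -> R, forall n, (0 < n)%N ->
  zero_list n (xi n) /\ interlace n (xi n) (xi n.+1).
Proof.
have step (nf : nat * (nat -> R)) : exists g, (0 < nf.1)%N ->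
    zero_list nf.1 nf.2 -> zero_list nf.1.+1 g /\ interlace nf.1 nf.2 g.
  have [[n0 zf]|h] := pselect ((0 < nf.1)%N /\ zero_list nf.1 nf.2).
    by have [g g1 g2] := zero_list_step n0 zf; exists g.
  by exists (fun=> 0) => n0 zf; exfalso; apply: h.
have [G GP] := choice step.
pose xi := nat_rect (fun=> nat -> R) (fun=> 0)
  (fun n f => if n == 0%N then fun=> 0 else G (n, f)).
have xiS n : (0 < n)%N -> xi n.+1 = G (n, xi n) by case: n.
have zl n : (0 < n)%N -> zero_list n (xi n).
  elim: n => [//|[|n] IHn] _; first exact: zero_list1.
  by rewrite xiS //; have [] := GP (n.+1, xi n.+1) isT (IHn isT).
exists xi => n n0; split; first exact: zl.
by rewrite xiS //; have [] := GP (n, xi n) n0 (zl n n0).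
Qed.

Section ZeroList.
Variables (n : nat) (f : nat -> R).
Hypotheses (n0 : (0 < n)%N) (zf : zero_list n f).

Definition zeros := [seq f j | j <- iota 1 n].

Lemma size_zeros : size zeros = n.
Proof. by rewrite size_map size_iota. Qed.

Lemma uniq_zeros : uniq zeros.
Proof.
rewrite map_inj_in_uniq ?iota_uniq // => j k; rewrite !mem_iota => jn kn e.
have [_ inc _ _] := zf; apply/eqP; case: ltngtP => // h.
  by have := inc j k ltac:(lia) h ltac:(lia); rewrite e ltxx.
by have := inc k j ltac:(lia) h ltac:(lia); rewrite e ltxx.
Qed.

Lemma all_root_zeros : all (root (P n)) zeros.
Proof.
apply/allP => _ /mapP[j jn ->]; have [rf _ _ _] := zf; apply: rf.
by move: jn; rewrite mem_iota; lia.
Qed.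

(** The degree is [n], so [n] distinct zeros exhaust the factorization. *)
Lemma p_real_factor :
  P n = lead_coef (P n) *: \prod_(z <- zeros) ('X - z%:P).
Proof.
apply: all_roots_prod_XsubC; first by rewrite size_p_real // size_zeros.
  exact: all_root_zeros.
by rewrite uniq_rootsE uniq_zeros.
Qed.

Lemma lead_coef_p_real_neq0 : lead_coef (P n) != 0.
Proof. by rewrite lead_coef_eq0 p_real_neq0. Qed.

Lemma mem_zeros z : root (P n) z = (z \in zeros).
Proof.
by rewrite p_real_factor rootZ ?lead_coef_p_real_neq0 // root_prod_XsubC.
Qed.

Lemma mup_zeros z : z \in zeros -> mup z (P n) = 1%N.
Proof.
move=> zin; rewrite p_real_factor -mul_polyC mupMr.
  by rewrite mu_prod_XsubC count_uniq_mem ?uniq_zeros // zin.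
by rewrite rootC lead_coef_p_real_neq0.
Qed.

End ZeroList.

End Zeros.

(** * The duplication formula *)

Section Duplication.
Variable R : realType.
Local Notation P n := (p_real R n).

(** The numerator of [p_n (1 / (1 - v))], as a rational function of [v] with
    denominator [(1 - v) ^ n]; it is an Eulerian polynomial up to a
    constant and a power of [v]. *)
Definition eulerian n : {poly R} :=
  \sum_(k < n.+1) (P n)`_k *: (1 - 'X) ^+ (n - k).

Lemma derivX_mul m :
  (1 - 'X) * ((1 - 'X) ^+ m)^`() = - m%:R *: (1 - 'X) ^+ m :> {poly R}.
Proof.
rewrite deriv_exp derivB derivX -[1%R]/(1%:P) derivC sub0r mulN1r.
case: m => [|m]; first by rewrite mulr0n oppr0 mulr0 scale0r.
by rewrite mulNrn mulrN mulrnAr -exprS scaleNr scaler_nat.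
Qed.

(** At [x = 1 / (1 - v)] one has [x (1 - x) d/dx = - v d/dv]; this is the
    differential recurrence of [p_n] for the numerators. *)
Lemma eulerian_rec n : (0 < n)%N ->
  eulerian n.+1 =
  n%:R^-1 *: (- 'X * ((1 - 'X) * (eulerian n)^`() + n%:R *: eulerian n)).
Proof.
move=> n0; have nz : (n%:R : R) != 0 by rewrite pnatr_eq0 -lt0n.
pose F : {poly R} := \sum_(k < n.+1) ((P n)`_k * k%:R) *: (1 - 'X) ^+ (n - k).
have -> : (1 - 'X) * (eulerian n)^`() + n%:R *: eulerian n = F.
  rewrite raddf_sum mulr_sumr scaler_sumr -big_split; apply: eq_bigr => k _ /=.
  rewrite derivZ -scalerAr derivX_mul !scalerA -scalerDl; congr (_ *: _).
  by rewrite natrB ?leq_ord //; ring.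
have coefS k : (P n.+1)`_k = n%:R^-1 *
    ((P n)`_k * k%:R - (if k is k'.+1 then (P n)`_k' * k'%:R else 0)).
  rewrite p_real_S // coefZ mulrBr mulr1 mulrBl coefB -!mulrA !coefXM.
  case: k => [|[|k]] /=; first by rewrite mulr0.
    by rewrite mulr0 !coef_deriv mulr1.
  by rewrite !coef_deriv !mulr_natr.
have -> : eulerian n.+1 = n%:R^-1 *: ((1 - 'X) * F - F).
  rewrite /eulerian (eq_bigr (fun k : 'I_n.+2 => n%:R^-1 *:
    (((P n)`_k * k%:R) *: (1 - 'X) ^+ (n.+1 - k) -
     (if val k is k'.+1 then (P n)`_k' * k'%:R else 0)
       *: (1 - 'X) ^+ (n.+1 - k)))); last first.
    by move=> k _; rewrite -scalerBl scalerA -coefS.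
  rewrite -scaler_sumr sumrB; congr (_ *: (_ - _)).
    rewrite big_ord_recr /= [(P n)`_n.+1]nth_default ?size_p_real //.
    rewrite mul0r scale0r addr0 /F mulr_sumr; apply: eq_bigr => k _.
    by rewrite -scalerAr -exprS subSn ?leq_ord.
  rewrite big_ord_recl /= scale0r add0r; apply: eq_bigr => k _.
  by rewrite /bump /= add1n subSS.
by congr (_ *: _); ring.
Qed.

Lemma eulerian1 : eulerian 1 = 1.
Proof.
rewrite /eulerian !big_ord_recl big_ord0 p_real_1 !coefX /=.
by rewrite scale0r add0r addr0 expr0 scale1r.
Qed.

(** Passing from [n] to [n + 1] is, up to a factor, the derivation [v d/dv] on
    the rational functions; it commutes with the substitution [v -> - v], and
    taking it after the substitution [v -> v ^ 2] costs a factor [2], which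
    accounts for the power [2 ^ n]. *)
Lemma eulerian_dup n : (0 < n)%N ->
  eulerian n * (1 + 'X) ^+ n + (eulerian n \Po - 'X) * (1 - 'X) ^+ n =
  2 ^+ n *: (eulerian n \Po 'X^2).
Proof.
case: n => // m _; elim: m => [|m IHm].
  have c1 (q : {poly R}) : 1 \Po q = 1 by exact: comp_polyC.
  by rewrite eulerian1 !c1 -mul_polyC rmorphXn rmorph_nat; ring.
have nzP : (m.+1%:R : {poly R}) != 0.
  by rewrite -polyC_natr polyC_eq0 pnatr_eq0.
set A := eulerian m.+1 in IHm *; set E := eulerian m.+2.
have eE : m.+1%:R * E = 'X * (('X - 1) * A^`() - m.+1%:R * A).
  rewrite /E eulerian_rec // -/A -!mul_polyC !mulrA -polyC_natr -polyCM.
  by rewrite divff ?pnatr_eq0 // mul1r; ring.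
have eB : m.+1%:R * (E \Po - 'X) =
    'X * ((1 + 'X) * (A^`() \Po - 'X) + m.+1%:R * (A \Po - 'X)).
  have := congr1 (comp_poly (- 'X)) eE.
  rewrite !comp_polyM !comp_polyB !comp_polyM !comp_polyB !comp_polyX.
  by rewrite -!polyC_natr !comp_polyC => ->; ring.
have eC : m.+1%:R * (E \Po 'X^2) =
    - 'X^2 * ((1 - 'X^2) * (A^`() \Po 'X^2) + m.+1%:R * (A \Po 'X^2)).
  have := congr1 (comp_poly 'X^2) eE.
  rewrite !comp_polyM !comp_polyB !comp_polyM !comp_polyB !comp_polyX.
  by rewrite -!polyC_natr !comp_polyC => ->; ring.
have := congr1 (@deriv R) IHm.
rewrite derivD !derivM derivZ !deriv_comp derivXn derivN derivX.
rewrite !deriv_exp derivB derivD derivX -[1%R]/(1%:P) derivC.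
move: IHm eE eB eC; rewrite -!mul_polyC !polyC1 !rmorphXn !rmorph_nat /=.
move: E A (E \Po - 'X) (E \Po 'X^2) (A^`()) (A^`() \Po - 'X)
  (A^`() \Po 'X^2) (A \Po - 'X) (A \Po 'X^2) => E A EB EC A1 B1 C1 B C.
move=> /eqP + eE eB eC /eqP; rewrite -subr_eq0 => /eqP IH.
rewrite add0r sub0r -subr_eq0 => /eqP dIH; apply: (mulfI nzP).
have -> : m.+1%:R * (E * (1 + 'X) ^+ m.+2 + EB * (1 - 'X) ^+ m.+2) =
    (m.+1%:R * E) * (1 + 'X) ^+ m.+2 + (m.+1%:R * EB) * (1 - 'X) ^+ m.+2.
  by ring.
rewrite [RHS]mulrCA eC eE eB; apply/eqP; rewrite -subr_eq0; apply/eqP.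
(* The difference of the two sides is a combination of the induction hypothesis
   and of its derivative. *)
rewrite -[RHS](_ : - 'X * (1 - 'X^2) * 0 - m.+1%:R *+ 2 * 'X^2 * 0 = 0);
  last by rewrite !mulr0 subr0.
by rewrite -{1}dIH -IH !exprS; ring.
Qed.

Lemma p_real_dup n (v : R[i]) : (0 < n)%N -> v != 1 -> v != -1 ->
  let Pc := map_poly (real_complex R) (P n) in
  Pc.[(1 - v)^-1] + Pc.[(1 + v)^-1] = 2 ^+ n * Pc.[(1 - v ^+ 2)^-1].
Proof.
move=> n0 v1 vN1 Pc.
pose Ec := map_poly (real_complex R) (eulerian n).
have EcE (w : R[i]) : w != 1 -> Ec.[w] = (1 - w) ^+ n * Pc.[(1 - w)^-1].
  move=> w1; have w0 : 1 - w != 0 by rewrite subr_eq0 eq_sym.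
  rewrite /Ec /eulerian rmorph_sum horner_sum (@horner_coef_wide _ n.+1); last first.
    by rewrite size_map_poly size_p_real.
  rewrite mulr_sumr; apply: eq_bigr => k _ /=.
  rewrite map_polyZ rmorphXn rmorphB rmorph1 /= map_polyX.
  rewrite hornerZ horner_exp hornerD hornerN hornerX -[1%R]/(1%:P) hornerC.
  rewrite mulrCA exprVn; congr (_ * _); first by rewrite [RHS]coef_map.
  have := leq_ord k; move: (nat_of_ord k) => {}k kn.
  by rewrite -{2}(subnK kn) exprD mulfK // expf_neq0.
have w1 : v ^+ 2 != 1 by rewrite sqrf_eq1 negb_or v1.
have vN : - v != 1 by rewrite eqr_oppLR.
have := congr1 (fun q => (map_poly (real_complex R) q).[v]) (eulerian_dup n0).
rewrite rmorphD !rmorphM !rmorphXn rmorphB rmorphD rmorph1 /= map_polyX.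
rewrite !map_comp_poly map_polyZ map_comp_poly /=.
rewrite rmorphN rmorphXn /= map_polyX -/Ec hornerD !hornerM !horner_comp.
rewrite !horner_exp !hornerD !hornerN !hornerX -[1%R]/(1%:P) !hornerC hornerZ.
rewrite horner_comp map_polyXn hornerXn !EcE // (rmorph_nat (real_complex R)).
have d1 : 1 - v != 0 by rewrite subr_eq0 eq_sym.
have d2 : 1 + v != 0 by rewrite addrC addr_eq0.
have d3 : 1 - v ^+ 2 = (1 - v) * (1 + v) by rewrite -subr_sqr expr1n.
rewrite opprK => h.
apply: (@mulfI _ ((1 - v ^+ 2) ^+ n)).
  by rewrite expf_neq0 // d3 mulf_neq0.
by rewrite [RHS]mulrCA -h d3 exprMn; ring.
Qed.

End Duplication.

(** * The complex exponential and the iterated duplication *)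

Section ComplexExp.
Variable R : realType.
Local Notation P n := (p_real R n).
Local Notation N := (@Normc.normc R).
Implicit Types z w y : R[i].

Definition cexp z : R[i] :=
  let: a +i* b := z in (expR a * cos b) +i* (expR a * sin b).

Lemma cexpD z w : cexp (z + w) = cexp z * cexp w.
Proof.
case: z w => [a b] [c d] /=.
simpc; rewrite /cexp expRD cosD sinD; congr (_ +i* _); ring.
Qed.

Lemma cexp0 : cexp 0 = 1.
Proof. by rewrite /= expR0 cos0 sin0 mulr1 mulr0. Qed.

Lemma cexpMn z n : cexp (z *+ n) = cexp z ^+ n.
Proof.
by elim: n => [|n IHn]; rewrite ?mulr0n ?cexp0 // mulrS exprS cexpD IHn.
Qed.

Lemma cexp_ipi : cexp (0 +i* pi) = -1.
Proof.
by rewrite /= expR0 cospi sinpi mulr0 mul1r -[0 in LHS]oppr0.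
Qed.

Lemma cexp_2ipi : cexp (two_pi_i R) = 1.
Proof.
by rewrite /two_pi_i /= mulr_natl expR0 cos2pi sin2pi mulr0 mul1r.
Qed.

Lemma cexp_period z k : cexp (z + two_pi_i R *+ k) = cexp z.
Proof. by rewrite cexpD cexpMn cexp_2ipi expr1n mulr1. Qed.

(** The polynomial [p_n] in the variable [y] for which [x = 1 / (1 - exp y)]: a
    function of period [2 pi i], with its poles at the multiples of this period. *)
Definition Phi n y : R[i] :=
  (map_poly (real_complex R) (P n)).[(1 - cexp y)^-1].

Lemma Phi_period n y k : Phi n (y + two_pi_i R *+ k) = Phi n y.
Proof. by rewrite /Phi cexp_period. Qed.

Lemma Phi_dup n y : (0 < n)%N -> cexp y != 1 ->
  Phi n y = 2 ^- n * (Phi n (y / 2) + Phi n ((y + two_pi_i R) / 2)).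
Proof.
move=> n0 y1.
have y2 : cexp y = cexp (y / 2) ^+ 2.
  by rewrite -cexpMn -[_ *+ 2]mulr_natr divfK ?pnatr_eq0.
have e : cexp ((y + two_pi_i R) / 2) = - cexp (y / 2).
  rewrite mulrDl cexpD (_ : two_pi_i R / 2 = 0 +i* pi) ?cexp_ipi ?mulrN1 //.
  rewrite (_ : two_pi_i R = 2 * (0 +i* pi)); last first.
    rewrite mulr_natl mulr2n; apply/eqP.
    by rewrite eq_complex /= addr0 mulr_natl mulr2n !eqxx.
  by rewrite mulrC mulKf // pnatr_eq0.
rewrite /Phi e opprK y2; move: y1; rewrite y2 sqrf_eq1 negb_or => /andP[v1 vN1].
by rewrite p_real_dup // mulKf // expf_neq0 // pnatr_eq0.
Qed.

Lemma Phi_mul n y m : (0 < n)%N -> cexp y != 1 ->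
  Phi n y = (2 ^+ m) ^- n *
    \sum_(j < 2 ^ m) Phi n ((y + two_pi_i R *+ j) / 2 ^+ m).
Proof.
move=> n0 y1; elim: m => [|m ->].
  by rewrite expn0 big_ord1 mulr0n addr0 !expr0 expr1n divr1 invr1 mul1r.
have tz k : (2 ^+ k : R[i]) != 0 by rewrite expf_neq0 // pnatr_eq0.
rewrite expnS mul2n -addnn big_split_ord /= -big_split /=.
have -> : (2 ^+ m.+1) ^- n = (2 ^+ m) ^- n * 2 ^- n :> R[i].
  by rewrite exprSr exprMn invfM.
rewrite -[RHS]mulrA; congr (_ * _); rewrite mulr_sumr.
apply: eq_bigr => j _.
rewrite Phi_dup //; last first.
  apply: contra y1 => /eqP h.
  rewrite -(cexp_period y j) -[_ + _](divfK (tz m)) -natrX mulr_natr cexpMn.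
  by rewrite natrX h expr1n.
have -> : (2 : R[i]) ^+ m.+1 = 2 ^+ m * 2 by rewrite exprSr.
rewrite invfM !mulrA; congr (_ * (_ + Phi _ _)).
rewrite mulrnDr addrCA addrC [in RHS]mulrDl [LHS]mulrDl [RHS]mulrDl.
congr (_ + _); congr (_ / _).
by rewrite -(mulr_natr _ (2 ^ m)%N) natrX mulfK.
Qed.

(** Folding the second half of the sum back by one period [2 pi i] makes the
    sum symmetric around [0]. *)
Lemma Phi_mul_sym n y m : (0 < n)%N -> cexp y != 1 ->
  Phi n y = (2 ^+ m.+1) ^- n * \sum_(k < 2 ^ m)
    (Phi n ((y + two_pi_i R *+ k) / 2 ^+ m.+1) +
     Phi n ((y - two_pi_i R *+ k.+1) / 2 ^+ m.+1)).
Proof.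
move=> n0 y1; rewrite {1}(Phi_mul m.+1 n0 y1); congr (_ * _).
rewrite expnS mul2n -addnn big_split_ord /= big_split /=; congr (_ + _).
rewrite [RHS](reindex_inj rev_ord_inj) /=; apply: eq_bigr => k _.
rewrite -[RHS](Phi_period _ _ 1) mulr1n; congr (Phi _ _).
have tz : (2 ^+ m.+1 : R[i]) != 0 by rewrite expf_neq0 // pnatr_eq0.
apply: (mulIf tz); rewrite [RHS]mulrDl !divfK //.
rewrite -natrX mulr_natr -[RHS]addrA; congr (_ + _).
rewrite addrC; apply/eqP; rewrite -subr_eq opprK.
rewrite -mulrnDr subnSK // expnS mul2n -addnn; apply/eqP.
by congr (_ *+ _); have := ltn_ord k; lia.
Qed.

End ComplexExp.

(** * Estimates of the exponential near its pole *)

Section RealBounds.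
Variable R : realType.
Implicit Types a b x : R.

Lemma sqr_le_norm a b : `|a| <= `|b| -> a ^+ 2 <= b ^+ 2.
Proof.
move=> ab; rewrite -[a ^+ 2]real_normK ?num_real //.
by rewrite -[b ^+ 2]real_normK ?num_real // lerXn2r ?nnegrE.
Qed.

Lemma sin_mvt x : exists2 c, `|c| <= `|x| & sin x = cos c * x.
Proof.
wlog x0 : x / 0 <= x.
  move=> H; have [/H//|x0] := leP 0 x.
  have [c cx e] := H (- x) ltac:(by rewrite oppr_ge0 ltW).
  exists c; first by rewrite normrN in cx.
  by apply: oppr_inj; rewrite -sinN e mulrN.
move: x0; rewrite le_eqVlt => /orP[/eqP <-|x0].
  by exists 0; rewrite ?sin0 ?mulr0.
have ct : {within `[0, x], continuous (@sin R)}.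
  by apply: continuous_subspaceT => z; exact: continuous_sin.
have [c cx] := @MVT R sin cos 0 x x0 (fun c _ => is_derive_sin c) ct.
rewrite sin0 !subr0 => e; exists c => //.
move: cx; rewrite in_itv /= => /andP[c0 cx].
by rewrite !ger0_norm ?ltW.
Qed.

Lemma normr_sin_le x : `|sin x| <= `|x|.
Proof.
by have [c _ ->] := sin_mvt x; rewrite normrM ler_piMl // cos_max.
Qed.

Lemma oneBcosE x : 1 - cos x = 2 * sin (x / 2) ^+ 2.
Proof.
have -> : cos x = cos ((x / 2) *+ 2) by rewrite -[_ *+ 2]mulr_natr divfK.
by rewrite cos_mulr2n sin2cos2; ring.
Qed.

Lemma oneBcos_le x : 1 - cos x <= x ^+ 2 / 2.
Proof.
rewrite oneBcosE.
have : sin (x / 2) ^+ 2 <= (x / 2) ^+ 2.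
  by rewrite sqr_le_norm // normr_sin_le.
by rewrite exprMn; lra.
Qed.

Lemma sinB_le x : `|x| <= 4 -> `|sin x - x| <= 2 * x ^+ 2.
Proof.
move=> x4; have [c cx ->] := sin_mvt x.
have -> : cos c * x - x = - ((1 - cos c) * x) by ring.
rewrite normrN normrM ger0_norm ?subr_ge0 ?cos_le1 //.
have := oneBcos_le c.
have : c ^+ 2 <= x ^+ 2 by rewrite sqr_le_norm.
have e : x ^+ 2 = `|x| ^+ 2 by rewrite real_normK // num_real.
rewrite e => h1 h2; have := normr_ge0 x => h0.
have h3 : 1 - cos c <= `|x| ^+ 2 / 2 by lra.
apply: le_trans (ler_wpM2r h0 h3) _.
by nra.
Qed.

Lemma oneBcos_ge x : `|x| <= pi -> x ^+ 2 / 8 <= 1 - cos x.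
Proof.
move=> xpi; rewrite oneBcosE; set w := x / 4.
(* Two duplications bring [x] into [-pi / 4, pi / 4], where [cos ^ 2 >= 1 / 2]. *)
have -> : x / 2 = w *+ 2 by rewrite /w -mulr_natr; field.
rewrite sin_mulr2n.
have cos2 c : `|c| <= `|w| -> 1 / 2 <= cos c ^+ 2.
  move=> cw; have : 0 <= cos (c *+ 2).
    rewrite cos_ge0_pihalf // -ler_norml normrMn.
    have : `|w| = `|x| / 4 by rewrite /w normrM normfV normr_nat.
    by rewrite -mulr_natr; lra.
  by rewrite cos_mulr2n -mulr_natr; lra.
have [c cw ->] := sin_mvt w.
have h1 := cos2 _ cw; have h2 := cos2 _ (lexx _).
have -> : x ^+ 2 = 16 * w ^+ 2 by rewrite /w; field.
have -> : 2 * ((cos w * (cos c * w)) *+ 2) ^+ 2 =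
  8 * (cos w ^+ 2 * cos c ^+ 2) * w ^+ 2 by ring.
have : 1 / 4 <= cos w ^+ 2 * cos c ^+ 2 by nra.
by have := sqr_ge0 w; nra.
Qed.

Lemma expR_small a : `|a| <= 1 / 2 ->
  [/\ 1 / 2 <= expR a, expR a <= 2 & `|expR a - 1 - a| <= 2 * a ^+ 2].
Proof.
rewrite ler_norml => /andP[a1 a2].
have h1 := expR_ge1Dx a; have h2 := expR_ge1Dx (- a).
have e0 := expR_gt0 a; have := expRN a; rewrite -div1r => eN.
have h3 : (1 - a) * expR a <= 1.
  by move: h2; rewrite eN ler_pdivlMr.
split; [lra|nra|]; rewrite ger0_norm; last lra.
by nra.
Qed.

Lemma expRB1_ge a : `|a| <= 1 / 2 -> a ^+ 2 / 4 <= (1 - expR a) ^+ 2.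
Proof.
rewrite ler_norml => /andP[a1 a2].
have h1 := expR_ge1Dx a; have h2 := expR_ge1Dx (- a).
have e0 := expR_gt0 a; have := expRN a; rewrite -div1r => eN.
have h3 : (1 - a) * expR a <= 1.
  by move: h2; rewrite eN ler_pdivlMr.
have [p|n] := leP 0 a; first by nra.
have : - a / 2 <= 1 - expR a by nra.
by nra.
Qed.

End RealBounds.

Section ComplexNorm.
Variable R : realType.
Local Notation N := (@Normc.normc R).
Implicit Types z w : R[i].

Lemma normc_ge0 z : 0 <= N z.
Proof. by case: z => a b; rewrite sqrtr_ge0. Qed.

Lemma normc_sqr z : N z ^+ 2 = complex.Re z ^+ 2 + complex.Im z ^+ 2.
Proof. by case: z => a b; rewrite sqr_sqrtr // addr_ge0 ?sqr_ge0. Qed.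

Lemma normc_gt0 z : z != 0 -> 0 < N z.
Proof.
move=> z0; rewrite lt_neqAle normc_ge0 andbT eq_sym.
by apply: contra z0 => /eqP/Normc.eq0_normc ->.
Qed.

Lemma normcX z n : N (z ^+ n) = N z ^+ n.
Proof.
elim: n => [|n IHn]; first by rewrite !expr0 Normc.normc1.
by rewrite !exprS Normc.normcM IHn.
Qed.

Lemma normc_real (a : R) : N a%:C = `|a|.
Proof. by rewrite /= expr0n addr0 sqrtr_sqr. Qed.

Lemma normc_sum (I : Type) (r : seq I) (Q : pred I) (F : I -> R[i]) :
  N (\sum_(i <- r | Q i) F i) <= \sum_(i <- r | Q i) N (F i).
Proof.
elim/big_ind2 : _ => [|x y a b h1 h2|//]; first by rewrite Normc.normc0.
by apply: (le_trans (le_normcD _ _)); exact: lerD.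
Qed.

Lemma normc_ge_Re z : `|complex.Re z| <= N z.
Proof.
rewrite -(@ler_pXn2r _ 2) ?nnegrE ?normc_ge0 ?normr_ge0 //.
by rewrite normc_sqr real_normK ?num_real // lerDl sqr_ge0.
Qed.

Lemma normc_ge_Im z : `|complex.Im z| <= N z.
Proof.
rewrite -(@ler_pXn2r _ 2) ?nnegrE ?normc_ge0 ?normr_ge0 //.
by rewrite normc_sqr real_normK ?num_real // lerDr sqr_ge0.
Qed.

Lemma normc_le_ReIm z : N z <= `|complex.Re z| + `|complex.Im z|.
Proof.
rewrite -(@ler_pXn2r _ 2) ?nnegrE ?normc_ge0 ?addr_ge0 //.
rewrite normc_sqr sqrrD !real_normK ?num_real //.
by rewrite -addrA lerD2l lerDr mulrn_wge0 // mulr_ge0.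
Qed.

Lemma normc_subC z w : N (z - w) = N (w - z).
Proof. by rewrite -normcN opprB. Qed.

End ComplexNorm.

Section CexpBounds.
Variable R : realType.
Local Notation N := (@Normc.normc R).
Implicit Types s : R[i].

(** A region around the pole [0] of [1 / (1 - exp s)] that stays away from the
    other poles and has the height of a full period. *)
Definition small_strip s := `|complex.Re s| <= 1 / 2 /\ `|complex.Im s| <= pi.

Lemma pi_lt4 : pi < 4 :> R.
Proof. by have := @pihalf_lt2 R; lra. Qed.

(** For [s = a + i b], [|1 - exp s| ^ 2 = (1 - exp a) ^ 2 + 2 exp a (1 - cos b)]. *)
Lemma oneBcexp_ge s : small_strip s -> N s / 4 <= N (1 - cexp s).
Proof.
case: s => a b [ha hb]; rewrite /= in ha hb.
rewrite -(@ler_pXn2r _ 2) ?nnegrE ?divr_ge0 ?normc_ge0 // exprMn !normc_sqr /=.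
have -> : (1 - expR a * cos b) ^+ 2 + (0 - expR a * sin b) ^+ 2 =
  (1 - expR a) ^+ 2 + 2 * expR a * (1 - cos b).
  have := cos2Dsin2 b; move: (cos b) (sin b) (expR a) => c d e h.
  have -> : (1 - e * c) ^+ 2 + (0 - e * d) ^+ 2 =
    1 - 2 * e * c + e ^+ 2 * (c ^+ 2 + d ^+ 2) by ring.
  by rewrite h; ring.
have h1 := expRB1_ge ha; have h2 := oneBcos_ge hb.
have [h3 _ _] := expR_small ha.
by have := sqr_ge0 b; have := sqr_ge0 a; nra.
Qed.

Lemma cexpB1_le s : small_strip s -> N (cexp s - 1 - s) <= 10 * N s ^+ 2.
Proof.
case: s => a b [ha hb]; rewrite /= in ha hb; apply: le_trans (normc_le_ReIm _) _.
rewrite normc_sqr /= subr0.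
have [h1 h2 h3] := expR_small ha.
have h4 := oneBcos_le b.
have h5 := sinB_le (le_trans hb (ltW pi_lt4)).
have h6 := normr_sin_le b; have h7 := cos_le1 b.
have -> : expR a * cos b - 1 - a = (expR a - 1 - a) - expR a * (1 - cos b).
  by ring.
have -> : expR a * sin b - b = (expR a - 1) * sin b + (sin b - b) by ring.
have k1 : `|expR a * (1 - cos b)| <= b ^+ 2.
  rewrite ger0_norm ?mulr_ge0 ?expR_ge0 ?subr_ge0 //.
  by have := sqr_ge0 b; nra.
have k2 : `|expR a - 1| <= 2 * `|a|.
  have -> : expR a - 1 = (expR a - 1 - a) + a by ring.
  apply: le_trans (ler_normD _ _) _.
  have : a ^+ 2 = `|a| ^+ 2 by rewrite real_normK // num_real.
  by have := normr_ge0 a; nra.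
have k3 : `|(expR a - 1) * sin b| <= a ^+ 2 + b ^+ 2.
  rewrite normrM; apply: le_trans (ler_pM _ _ k2 h6) _ => //.
  have <- : `|a| ^+ 2 = a ^+ 2 by rewrite real_normK // num_real.
  have <- : `|b| ^+ 2 = b ^+ 2 by rewrite real_normK // num_real.
  by have := sqr_ge0 (`|a| - `|b|); nra.
have k4 := ler_normB (expR a - 1 - a) (expR a * (1 - cos b)).
have k5 := ler_normD ((expR a - 1) * sin b) (sin b - b).
by have := sqr_ge0 b; have := sqr_ge0 a; lra.
Qed.

(** [1 / (1 - exp s)] has a simple pole with residue [-1] at [0]. *)
Lemma pole_estimate s : s != 0 -> small_strip s ->
  [/\ cexp s != 1, N (s / (1 - cexp s)) <= 4 &
      N (1 + s / (1 - cexp s)) <= 40 * N s].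
Proof.
move=> s0 ss; have l := oneBcexp_ge ss; have u := cexpB1_le ss.
have ns := normc_gt0 s0.
have n1 : 0 < N (1 - cexp s) by apply: lt_le_trans l; rewrite divr_gt0.
have e1 : 1 - cexp s != 0.
  by apply/negP => /eqP e; move: n1; rewrite e Normc.normc0 ltxx.
split; first by rewrite -subr_eq0 -opprB oppr_eq0.
  by rewrite Normc.normcM Normc.normcV ler_pdivrMr // -ler_pdivrMl // mulrC.
have -> : 1 + s / (1 - cexp s) = - ((cexp s - 1 - s) / (1 - cexp s)).
  by field.
rewrite normcN Normc.normcM Normc.normcV ler_pdivrMr //.
by apply: (le_trans u); move: (N s) (N _) ns l n1 => x y; nra.
Qed.

End CexpBounds.

(** * The partial fraction expansion *)

Section Expansion.
Variable R : realType.
Local Notation P n := (p_real R n).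
Local Notation N := (@Normc.normc R).
Implicit Types s w y z : R[i].

Lemma one_subX_le n : exists2 C : R, 0 <= C &
  forall z, N z <= 4 -> N (1 - z ^+ n) <= C * N (1 - z).
Proof.
elim: n => [|n [C C0 IHn]].
  by exists 0 => // z _; rewrite expr0 subrr Normc.normc0 mul0r.
exists (C + 4 ^+ n) => [|z z4]; first by rewrite addr_ge0 // exprn_ge0.
have -> : 1 - z ^+ n.+1 = (1 - z ^+ n) + z ^+ n * (1 - z).
  by rewrite exprSr; ring.
apply: (le_trans (le_normcD _ _)); rewrite mulrDl lerD ?IHn //.
rewrite Normc.normcM normcX ler_wpM2r ?normc_ge0 //.
by rewrite lerXn2r ?nnegrE ?normc_ge0.
Qed.

Lemma normc_small_strip s : small_strip s -> N s <= 5.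
Proof.
move=> [h1 h2]; apply: (le_trans (normc_le_ReIm _)).
by have := @pi_lt4 R; lra.
Qed.

(** The leading coefficient of [p_n] is [(-1) ^ (n - 1)] and [1 / (1 - exp s)]
    behaves like [- 1 / s], hence [Phi n s ~ - s ^ (- n)] near [0]. *)
Lemma Phi_leading n : (0 < n)%N -> exists2 C : R, 0 <= C &
  forall s, s != 0 -> small_strip s -> N (s ^+ n * Phi n s + 1) <= C * N s.
Proof.
move=> n0; have [C2 C20 C2P] := one_subX_le n.
pose C1 : R := \sum_(k < n) `|(P n)`_k| * (5 ^+ n * 4 ^+ n).
exists (C1 + C2 * 40).
  rewrite addr_ge0 ?mulr_ge0 //; apply: sumr_ge0 => k _.
  by rewrite !mulr_ge0 ?exprn_ge0.
move=> s s0 ss; have [e1 h4 h1] := pole_estimate s0 ss.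
have s5 := normc_small_strip ss; have ns := normc_gt0 s0.
set h := s / (1 - cexp s) in h4 h1.
have -> : s ^+ n * Phi n s =
    \sum_(k < n.+1) ((P n)`_k)%:C * (s ^+ (n - k) * h ^+ k).
  rewrite /Phi (@horner_coef_wide _ n.+1); last first.
    by rewrite size_map_poly size_p_real.
  rewrite mulr_sumr; apply: eq_bigr => k _; rewrite [in LHS]coef_map /=.
  rewrite mulrCA; congr (_ * _).
  by rewrite /h exprMn mulrA -exprD subnK // -ltnS.
rewrite big_ord_recr /= -addrA mulrDl.
apply: (le_trans (le_normcD _ _)); apply: lerD.
  apply: (le_trans (normc_sum _ _ _)); rewrite mulr_suml; apply: ler_sum => k _.
  rewrite !Normc.normcM !normcX normc_real -!mulrA ler_wpM2l //.
  have -> : (n - k = (n - k).-1.+1)%N by have := ltn_ord k; lia.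
  have p5 : N s ^+ (n - k).-1 <= 5 ^+ n.
    apply: le_trans (_ : 5 ^+ (n - k).-1 <= _).
      by rewrite lerXn2r ?nnegrE ?normc_ge0.
    by rewrite ler_eXn2l ?ltr1n //; lia.
  have p4 : N h ^+ k <= 4 ^+ n.
    apply: le_trans (_ : 4 ^+ k <= _).
      by rewrite lerXn2r ?nnegrE ?normc_ge0.
    by rewrite ler_eXn2l ?ltr1n // ltnW.
  rewrite exprS -!mulrA mulrC -mulrA; apply: ler_pM => //.
  - by rewrite exprn_ge0 ?normc_ge0.
  - by rewrite mulr_ge0 ?exprn_ge0 ?normc_ge0.
  - by rewrite ler_wpM2r // normc_ge0.
rewrite subnn expr0 mul1r lead_p_real // rmorphXn rmorphN1.
have -> : (-1) ^+ n.-1 * h ^+ n + 1 = 1 - (- h) ^+ n.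
  by rewrite -(prednK n0) (exprNn h) !exprS /=; ring.
apply: le_trans (C2P _ _) _; first by rewrite normcN.
by rewrite opprK -mulrA ler_wpM2l.
Qed.

(** With [s = w / M], the left-hand side is [w ^ (- n) (s ^ n Phi n s + 1)]; as
    [n >= 2], the power [w ^ (- n)] absorbs the factor [|w|] of the error and
    leaves another [1 / |w|]. *)
Lemma Phi_term n : (2 <= n)%N -> exists2 C : R, 0 <= C &
  forall w (M : R), 1 <= N w -> 0 < M -> small_strip (w / M%:C) ->
  N (M%:C ^- n * Phi n (w / M%:C) + w ^- n) <= C / (M * N w).
Proof.
move=> n2; have [C C0 CP] := Phi_leading (ltnW n2); exists C => // w M w1 M0 ss.
have w0 : w != 0.
  by apply/negP => /eqP e; move: w1; rewrite e Normc.normc0 ler10.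
have MC0 : M%:C != 0 :> R[i] by rewrite eq_complex /= eqxx andbT gt_eqF.
set s := w / M%:C in ss *.
have s0 : s != 0 by rewrite mulf_neq0 // invr_eq0.
have -> : M%:C ^- n * Phi n s + w ^- n = w ^- n * (s ^+ n * Phi n s + 1).
  by rewrite mulrDr mulr1 /s exprMn !mulrA mulVf ?expf_neq0 // mul1r exprVn.
rewrite Normc.normcM Normc.normcV normcX.
have h := CP _ s0 ss.
have nw : 0 < N w by apply: lt_le_trans w1.
apply: le_trans (ler_wpM2l _ h) _; first by rewrite invr_ge0 exprn_ge0 // ltW.
rewrite /s Normc.normcM Normc.normcV normc_real (gtr0_norm M0).
have -> : (N w ^+ n)^-1 * (C * (N w / M)) = C / (M * N w) * (N w ^+ (n - 2))^-1.
  rewrite -{1}(subnK n2) exprD.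
  have := expf_neq0 (n - 2) (lt0r_neq0 nw); move: (N w ^+ (n - 2)) => u u0.
  by field; rewrite u0 !lt0r_neq0.
rewrite ler_piMr ?divr_ge0 ?mulr_ge0 ?(ltW M0) ?(ltW nw) //.
by rewrite invf_le1 ?exprn_gt0 // exprn_ege1.
Qed.

Lemma mean_harmonic_small (eps : R) : 0 < eps -> exists m0, forall m, (m0 <= m)%N ->
  (\sum_(k < 2 ^ m) k.+1%:R^-1) / 2 ^+ m <= eps.
Proof.
move=> e0; have := @cesaro R _ _ (@cvg_harmonic R).
move=> /cvgrPdist_le/(_ _ e0)[m0 _ H]; exists m0 => m mm.
have km : (2 ^ m).-1.+1 = (2 ^ m)%N by rewrite prednK ?expn_gt0.
have /H : (m0 <= (2 ^ m).-1)%N.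
  by have := ltn_expl m (isT : (1 < 2)%N); lia.
rewrite /= /arithmetic_mean /series /= km sub0r normrN big_mkord natrX.
by rewrite mulrC; apply: le_trans; exact: ler_norm.
Qed.

Lemma two_pi_iMn k : two_pi_i R *+ k = 0 +i* (2 * pi * k%:R).
Proof.
elim: k => [|k IHk]; first by rewrite mulr0n mulr0.
rewrite mulrS IHk; apply/eqP; rewrite eq_complex /= addr0 eqxx /=.
by rewrite -natr1; apply/eqP; ring.
Qed.

Lemma divc_real (a b M : R) : M != 0 ->
  (a +i* b) / M%:C = (a / M) +i* (b / M) :> R[i].
Proof.
move=> M0; have MC0 : M%:C != 0 :> R[i] by rewrite eq_complex /= eqxx andbT.
apply: (mulIf MC0); rewrite divfK //; apply/eqP; rewrite eq_complex /=.
by rewrite !mulr0 subr0 add0r !divfK ?eqxx.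
Qed.

(** The partial fraction expansion of [p_n (1 / (1 - exp y))], along the
    partial sums of length [2 ^ m]: in the symmetrized duplication formula each
    term is compared with the leading part of [Phi n] at its pole; the total
    error is a mean of the harmonic sequence. *)
Lemma Phi_expansion n y (eps : R) : (2 <= n)%N -> complex.Im y = pi -> 0 < eps ->
  exists m0, forall m, (m0 <= m)%N ->
  N (Phi n y + \sum_(k < 2 ^ m)
       ((y + two_pi_i R *+ k) ^- n + (y - two_pi_i R *+ k.+1) ^- n)) <= eps.
Proof.
case: y => t b /= n2 -> e0; set y := t +i* pi.
have [C C0 CP] := Phi_term n2.
have e1 : 0 < eps / (C + 1) by rewrite divr_gt0 // ltr_wpDl.
have [m1 m1P] := mean_harmonic_small e1.
have pi2 := @pi_ge2 R.
exists (maxn m1 (Num.bound `|t|)) => m; rewrite geq_max => /andP[mm1 mm2].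
pose M : R := 2 ^+ m.+1.
have M0 : 0 < M by rewrite exprn_gt0.
have ME : (2 ^+ m.+1 : R[i]) = M%:C by rewrite rmorphXn rmorph_nat.
have tM : `|t| <= 2 ^+ m.
  apply: le_trans (ltW (archi_boundP (normr_ge0 t))) _.
  rewrite -natrX ler_nat; apply: (leq_trans mm2).
  exact/ltnW/ltn_expl.
have y1 : cexp y != 1.
  rewrite /= cospi sinpi eq_complex /= mulr0 eqxx andbT.
  by have := expR_gt0 t; apply: contraTneq; lra.
rewrite (Phi_mul_sym m (ltnW n2) y1) mulr_sumr -big_split /=.
have main (k : 'I_(2 ^ m)) (w : R[i]) : complex.Re w = t ->
    `|complex.Im w| = pi * (2 * k%:R + 1) ->
    N ((2 ^+ m.+1) ^- n * Phi n (w / 2 ^+ m.+1) + w ^- n)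
    <= C / 2 * (k.+1%:R^-1 / 2 ^+ m).
  move=> rw iw.
  have kw : k.+1%:R <= N w.
    apply: le_trans (normc_ge_Im _); rewrite iw -natr1.
    by have := ler0n R k; nra.
  have k0 : (0 : R) < k.+1%:R by rewrite ltr0n.
  rewrite ME; apply: le_trans (CP _ _ _ M0 _) _.
  - by apply: le_trans kw; rewrite ler1n.
  - case: w rw iw {kw} => a b' /= -> iw.
    rewrite divc_real ?lt0r_neq0 //; split => /=;
      rewrite normrM normfV (gtr0_norm M0).
    + by rewrite ler_pdivrMr // /M exprS; lra.
    + rewrite iw ler_pdivrMr // ler_wpM2l ?pi_ge0 // /M -natrX.
      rewrite -natrM natr1 ler_nat expnS; have := ltn_ord k.
      by lia.
  rewrite /M exprS; have q0 : (0 : R) < 2 ^+ m by rewrite exprn_gt0.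
  rewrite -(mulrA C) ler_wpM2l // -!invfM lef_pV2 ?posrE.
  - by rewrite -mulrA ler_wpM2l // mulrC ler_wpM2l // ltW.
  - by rewrite !mulr_gt0 // (lt_le_trans k0).
  - by rewrite !mulr_gt0.
apply: (le_trans (normc_sum _ _ _)).
apply: (@le_trans _ _ (C * ((\sum_(k < 2 ^ m) k.+1%:R^-1) / 2 ^+ m))).
  rewrite mulr_suml mulr_sumr; apply: ler_sum => k _.
  rewrite mulrDr addrACA; apply: (le_trans (le_normcD _ _)).
  rewrite [leRHS](_ : _ = C / 2 * (k.+1%:R^-1 / 2 ^+ m) +
    C / 2 * (k.+1%:R^-1 / 2 ^+ m)); last by rewrite -mulrDl; congr (_ * _); lra.
  have hp := @pi_ge0 R; have hk := ler0n R k.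
  apply: lerD; apply: main; rewrite two_pi_iMn /= ?addr0 ?oppr0 ?addr0 //.
    by rewrite ger0_norm; [ring | nra].
  by rewrite ler0_norm -?natr1; [ring | nra].
apply: le_trans (ler_wpM2l C0 (m1P m mm1)) _.
rewrite mulrA ler_pdivrMr ?ltr_wpDl //.
by nra.
Qed.

End Expansion.

(** * The Hurwitz zeta function *)

Section ComplexSeries.
Variable R : realType.
Local Notation N := (@Normc.normc R).

(** Convergence in the complex plane; a real tolerance spares the partial order
    of the complex numbers. *)
Definition ccvg (u : nat -> R[i]) (l : R[i]) : Prop :=
  forall e : R, 0 < e -> exists n0, forall n, (n0 <= n)%N -> N (u n - l) <= e.

Lemma ccvg_lim (f : nat -> R[i]) l : ccvg (series f) l ->
  limn (series (f : nat -> R[i]^o)) = l.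
Proof.
move=> ul; apply: cvg_lim; first exact: norm_hausdorff.
apply/(@cvgrPdist_le _ R[i]^o) => -[e e'] /=.
rewrite ltcE /= => /andP[/eqP -> e0].
have [n0 n0P] := ul e e0; exists n0 => // n /= nn0.
rewrite -[X in X <= _]/((N (l - series f n))%:C) lecR normc_subC.
exact: n0P.
Qed.

Lemma ccvgZ (u : nat -> R[i]) l c : ccvg u l -> ccvg (fun n => c * u n) (c * l).
Proof.
move=> ul e e0; have c0 : 0 < N c + 1 by rewrite ltr_wpDl ?normc_ge0.
have [n0 n0P] := ul _ (divr_gt0 e0 c0); exists n0 => n /n0P h.
rewrite -mulrBr Normc.normcM; apply: le_trans (ler_wpM2l (normc_ge0 c) h) _.
by rewrite mulrA ler_pdivrMr // mulrC ler_wpM2l ?lerDl ?(ltW e0).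
Qed.

(** The bound telescopes: [1 / k ^ 2 <= 2 / k - 2 / (k + 1)] for [k >= 1]. *)
Lemma sum_inv_sqr_le (K : nat) :
  \sum_(0 <= k < K) (k.+1%:R ^+ 2)^-1 <= 2 - 2 / K.+1%:R :> R.
Proof.
elim: K => [|K IHK]; first by rewrite big_geq // divr1 subrr.
rewrite big_nat_recr //=; apply: le_trans (lerD IHK (lexx _)) _.
have k0 := ler0n R K; have -> : K.+2%:R = K%:R + 2 :> R by rewrite -addn2 natrD.
rewrite -(natr1 K); move: (K%:R) k0 => x x0.
have x1 : x + 1 != 0 by lra.
have x2 : x + 2 != 0 by lra.
rewrite -subr_ge0.
have -> : 2 - 2 / (x + 2) - (2 - 2 / (x + 1) + ((x + 1) ^+ 2)^-1) =
  x / ((x + 2) * (x + 1) ^+ 2) by field; rewrite x1 x2.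
by rewrite divr_ge0 ?mulr_ge0 ?exprn_ge0; lra.
Qed.

Lemma cvg_series_inv_sqr : cvgn (series (fun k => (k.+1%:R ^+ 2)^-1 : R)).
Proof.
apply: nondecreasing_is_cvgn.
  by apply: nondecreasing_series => k _ _; rewrite invr_ge0 exprn_ge0.
exists 2 => _ [K _ <-]; rewrite /series /=; apply: (le_trans (sum_inv_sqr_le K)).
by rewrite gerBl divr_ge0.
Qed.

Lemma ccvg_series (f : nat -> R[i]) :
  (forall j, N (f j) <= (j.+1%:R ^+ 2)^-1) -> exists l, ccvg (series f) l.
Proof.
move=> fb.
have real_part (h : nat -> R) : (forall j, `|h j| <= N (f j)) ->
    exists l, forall e, 0 < e -> exists n0, forall n, (n0 <= n)%N ->
      `|series h n - l| <= e.
  move=> hf; have ch : cvgn (series h).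
    apply: normed_cvg; apply: (@series_le_cvg _ _ (fun k => (k.+1%:R ^+ 2)^-1)).
    - by move=> k /=.
    - by move=> k; rewrite invr_ge0 exprn_ge0.
    - by move=> k /=; apply: le_trans (hf k) (fb k).
    - exact: cvg_series_inv_sqr.
  exists (limn (series h)) => e e0.
  move/cvgrPdist_le: ch => /(_ _ e0)[n0 _ H]; exists n0 => n nn0.
  by rewrite distrC; apply: H.
have [a aP] := real_part (fun j => complex.Re (f j)) (fun j => normc_ge_Re _).
have [b bP] := real_part (fun j => complex.Im (f j)) (fun j => normc_ge_Im _).
exists (a +i* b) => e e0; have e2 : 0 < e / 2 by rewrite divr_gt0.
have [n1 H1] := aP _ e2; have [n2 H2] := bP _ e2.
exists (maxn n1 n2) => n; rewrite geq_max => /andP[/H1 h1 /H2 h2].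
apply: (le_trans (normc_le_ReIm _)).
have ReS : complex.Re (series f n) = series (fun j => complex.Re (f j)) n.
  rewrite /series /=; apply: (big_morph (@complex.Re R) _ _) => //.
  by case=> ? ? [].
have ImS : complex.Im (series f n) = series (fun j => complex.Im (f j)) n.
  rewrite /series /=; apply: (big_morph (@complex.Im R) _ _) => //.
  by case=> ? ? [].
rewrite -ReS in h1; rewrite -ImS in h2; rewrite [e in leRHS]splitr.
by move: h1 h2; case: (series f n) => c d /= h1 h2; apply: lerD.
Qed.

End ComplexSeries.

Section Hurwitz.
Variable R : realType.
Local Notation P n := (p_real R n).
Local Notation N := (@Normc.normc R).
Implicit Types x : R.

Lemma y0E x : 0 < x < 1 -> y0 x = (ln ((1 - x) / x)) +i* pi.
Proof.
move=> /andP[x0 x1]; rewrite /y0 /clog /=; congr (_ +i* _).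
rewrite !subr0 !expr0n /= !addr0 !sqrtr_sqr ln_div ?posrE ?subr_gt0 //.
by rewrite (gtr0_norm x0) ltr0_norm ?subr_lt0 // opprB.
Qed.

Lemma Phi_y0 n x : 0 < x < 1 -> Phi n (y0 x) = ((P n).[x])%:C.
Proof.
move=> x01; rewrite y0E //; move/andP: x01 => [x0 x1].
rewrite /Phi /cexp cospi sinpi lnK ?posrE ?divr_gt0 ?subr_gt0 // mulr0 mulrN1.
have -> : (1 - (- ((1 - x) / x) +i* 0)) = (x^-1)%:C :> R[i].
  apply/eqP; rewrite eq_complex /= subr0 eqxx andbT; apply/eqP.
  by field; rewrite lt0r_neq0.
by rewrite -fmorphV invrK /= horner_map.
Qed.

Lemma normc_shift (y : R[i]) k : complex.Im y = pi ->
  k.+1%:R <= N (y + two_pi_i R *+ k) /\ k.+1%:R <= N (y - two_pi_i R *+ k.+1).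
Proof.
case: y => t b /= ->; have p2 := @pi_ge2 R; have k0 := ler0n R k.
split; apply: le_trans (normc_ge_Im _); rewrite two_pi_iMn /= -!natr1.
  by rewrite ger0_norm; nra.
by rewrite ler0_norm; nra.
Qed.

Lemma normc_invX_le (w : R[i]) n k : (2 <= n)%N -> k.+1%:R <= N w ->
  N (w ^- n) <= (k.+1%:R ^+ 2)^-1.
Proof.
move=> n2 kw; have k0 : (0 : R) < k.+1%:R by rewrite ltr0n.
have k1 : 1 <= N w by apply: le_trans kw; rewrite ler1n.
rewrite Normc.normcV normcX lef_pV2 ?posrE ?exprn_gt0 ?(lt_le_trans k0) //.
apply: (@le_trans _ _ (N w ^+ 2)).
  by rewrite lerXn2r ?nnegrE ?normc_ge0 // ltW.
by rewrite ler_weXn2l.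
Qed.

Lemma two_pi_i_neq0 : two_pi_i R != 0.
Proof.
by rewrite eq_complex /= eqxx /= mulf_neq0 ?pnatr_eq0 // gt_eqF ?pi_gt0.
Qed.

(** With [a = y / (2 pi i)], the terms of the two series are
    [(j + a) ^ (- n) = (2 pi i) ^ n (y + 2 pi i j) ^ (- n)] and
    [(j + 1 - a) ^ (- n) = (- 2 pi i) ^ n (y - 2 pi i (j + 1)) ^ (- n)]. Both series
    converge, so their sum can be computed along the partial sums of length
    [2 ^ m]. *)
Lemma hurwitz_expansion x n : 0 < x < 1 -> (2 <= n)%N ->
  ((P n).[x])%:C =
    - 1 / two_pi_i R ^+ n *
    (hurwitz_zeta n (y0 x / two_pi_i R) +
     (-1) ^+ n * hurwitz_zeta n (1 - y0 x / two_pi_i R)).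
Proof.
move=> x01 n2; set y := y0 x; set tau := two_pi_i R.
have t0 : tau != 0 := two_pi_i_neq0.
have iy : complex.Im y = pi by [].
pose f j := (y + tau *+ j) ^- n; pose g j := (y - tau *+ j.+1) ^- n.
have [U UP] : exists U, ccvg (series f) U.
  apply: ccvg_series => j; apply: normc_invX_le => //.
  by have [] := normc_shift j iy.
have [V VP] : exists V, ccvg (series g) V.
  apply: ccvg_series => j; apply: normc_invX_le => //.
  by have [] := normc_shift j iy.
have scale (h : nat -> R[i]) c : series (fun j => c * h j) = fun m => c * series h m.
  by apply: funext => m; rewrite /series /= mulr_sumr.
have -> : hurwitz_zeta n (y / tau) = tau ^+ n * U.
  have cU : ccvg (series (fun j => tau ^+ n * f j)) (tau ^+ n * U).
    by rewrite scale; exact: ccvgZ.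
  rewrite -(ccvg_lim cU).
  apply: (congr1 (fun h : nat -> R[i]^o => limn (series h))).
  apply: funext => j.
  rewrite /f -exprVn -[(_ + _) ^- n]exprVn -exprMn; congr (_ ^+ _).
  have -> : j%:R + y / tau = (y + tau *+ j) / tau.
    by rewrite mulrDl -(mulr_natr tau j) mulrAC divff // mul1r addrC.
  by rewrite invfM invrK mulrC.
have -> : hurwitz_zeta n (1 - y / tau) = (- tau) ^+ n * V.
  have cV : ccvg (series (fun j => (- tau) ^+ n * g j)) ((- tau) ^+ n * V).
    by rewrite scale; exact: ccvgZ.
  rewrite -(ccvg_lim cV).
  apply: (congr1 (fun h : nat -> R[i]^o => limn (series h))).
  apply: funext => j.
  rewrite /g -exprVn -[(_ - _) ^- n]exprVn -exprMn; congr (_ ^+ _).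
  have -> : j%:R + (1 - y / tau) = (y - tau *+ j.+1) / - tau.
    rewrite invrN mulrN mulrBl -(mulr_natr tau) mulrAC divff // mul1r -natr1.
    by ring.
  by rewrite invfM invrK mulrC.
suff -> : ((P n).[x])%:C = - (U + V).
  have -> : (-1) ^+ n * ((- tau) ^+ n * V) = tau ^+ n * V.
    by rewrite mulrA -exprMn mulrNN mul1r.
  by field; rewrite expf_neq0.
rewrite -Phi_y0 // -/y; apply/eqP; rewrite -subr_eq0 opprK; apply/eqP.
apply: Normc.eq0_normc; apply/eqP; rewrite eq_le normc_ge0 andbT.
apply/ler_addgt0Pl => e e0; rewrite addr0.
have e3 : 0 < e / 3 by rewrite divr_gt0.
have [m0 H0] := Phi_expansion n2 iy e3.
have [n1 H1] := UP _ e3; have [n3 H3] := VP _ e3.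
pose m := maxn m0 (maxn n1 n3).
have big k : (k <= m)%N -> (k <= 2 ^ m)%N.
  by move=> km; apply: (leq_trans km); apply/ltnW/ltn_expl.
have /H1 h1 : (n1 <= 2 ^ m)%N by apply: big; rewrite /m; lia.
have /H3 h3 : (n3 <= 2 ^ m)%N by apply: big; rewrite /m; lia.
have := H0 m (leq_maxl _ _); rewrite big_split /=.
rewrite -(big_mkord xpredT f) -(big_mkord xpredT g).
rewrite -[\sum_(0 <= i < _) f i]/(series f (2 ^ m)%N).
rewrite -[\sum_(0 <= i < _) g i]/(series g (2 ^ m)%N).
move: (series f _) (series g _) h1 h3 => u v h1 h3 h0.
have -> : Phi n y + (U + V) = (Phi n y + (u + v)) - (u - U) - (v - V) by ring.
apply: le_trans (le_normcD _ _) _; rewrite normcN.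
have := le_normcD (Phi n y + (u + v)) (- (u - U)); rewrite normcN.
by move: h0 h1 h3; lra.
Qed.

End Hurwitz.

(** * Signs of the polynomials for large index *)

Section Sign.
Variable R : realType.
Local Notation P n := (p_real R n).
Local Notation N := (@Normc.normc R).
Implicit Types x t T : R.

Lemma normc_shift_sqr t k :
  N ((t +i* pi) + two_pi_i R *+ k) ^+ 2 = t ^+ 2 + pi ^+ 2 * (2 * k%:R + 1) ^+ 2 /\
  N ((t +i* pi) - two_pi_i R *+ k.+1) ^+ 2 =
    t ^+ 2 + pi ^+ 2 * (2 * k%:R + 1) ^+ 2.
Proof.
rewrite !two_pi_iMn !normc_sqr /= ?addr0 ?oppr0 ?addr0 -natr1.
by split; congr (_ + _); ring.
Qed.

Section Ratio.
Variable T : R.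

(** The largest possible ratio [|t + i pi| / |t + 3 i pi|] for [|t| <= T]. *)
Definition tail_ratio : R :=
  Num.sqrt ((T ^+ 2 + pi ^+ 2) / (T ^+ 2 + 9 * pi ^+ 2)).

Lemma pi2_gt0 : 0 < pi ^+ 2 :> R.
Proof. by rewrite exprn_gt0 ?pi_gt0. Qed.

Lemma tail_ratio_ge0 : 0 <= tail_ratio.
Proof. exact: sqrtr_ge0. Qed.

Lemma tail_ratio_sqr :
  tail_ratio ^+ 2 = (T ^+ 2 + pi ^+ 2) / (T ^+ 2 + 9 * pi ^+ 2).
Proof.
have := pi2_gt0; have := sqr_ge0 T => h1 h2.
by rewrite sqr_sqrtr // divr_ge0 //; lra.
Qed.

Lemma tail_ratio_lt1 : tail_ratio < 1.
Proof.
have := pi2_gt0; have := sqr_ge0 T => h1 h2.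
rewrite -(@ltr_pXn2r _ 2) ?nnegrE ?tail_ratio_ge0 // expr1n tail_ratio_sqr.
by rewrite ltr_pdivrMr ?mul1r; lra.
Qed.

(** For [|t| <= T], every pole but the two nearest ones is further away than the
    nearest one by a factor bounded away from [1]; two of the [n] powers of the
    ratio are kept to sum over the poles. *)
Lemma ratioX_le t n k (w : R[i]) : (2 <= n)%N -> (1 <= k)%N -> `|t| <= T ->
  N w ^+ 2 = t ^+ 2 + pi ^+ 2 * (2 * k%:R + 1) ^+ 2 ->
  N (t +i* pi) ^+ n * N (w ^- n) <=
    tail_ratio ^+ (n - 2) * (T ^+ 2 + pi ^+ 2) * (k.+1%:R ^+ 2)^-1.
Proof.
move=> n2 k1 tT wE.
have p0 := pi2_gt0.
have t2 : t ^+ 2 <= T ^+ 2.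
  by rewrite sqr_le_norm // (le_trans tT) // ler_norm.
have t0 := sqr_ge0 t.
have k1' : 1 <= k%:R :> R by rewrite ler1n.
have kk : 9 <= (2 * k%:R + 1) ^+ 2 :> R.
  by rewrite expr2; nra.
have w2 : 0 < N w ^+ 2 by rewrite wE; nra.
have w0 : 0 < N w.
  rewrite lt_neqAle normc_ge0 andbT eq_sym.
  by apply: contraTneq w2 => ->; rewrite expr0n ltxx.
have yE : N (t +i* pi) ^+ 2 = t ^+ 2 + pi ^+ 2 by rewrite normc_sqr.
rewrite Normc.normcV normcX -expr_div_n.
set r := _ / _; have r0 : 0 <= r by rewrite divr_ge0 ?normc_ge0.
have r2 : r ^+ 2 = (t ^+ 2 + pi ^+ 2) / N w ^+ 2 by rewrite expr_div_n yE.
have rq : r <= tail_ratio.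
  rewrite -(@ler_pXn2r _ 2) ?nnegrE ?tail_ratio_ge0 // tail_ratio_sqr r2.
  rewrite ler_pdivrMr // mulrAC ler_pdivlMr; last by nra.
  rewrite wE; set B := pi ^+ 2 * _.
  have : 9 * pi ^+ 2 <= B by rewrite /B; nra.
  move: B (T ^+ 2) (pi ^+ 2) (t ^+ 2) t2 t0 p0 => B a p b ab b0 p0 hB.
  apply: (@le_trans _ _ ((a + p) * (b + 9 * p))).
    have : 0 <= p * (a - b) by rewrite mulr_ge0 ?subr_ge0 // ltW.
    by nra.
  by rewrite ler_wpM2l // ?lerD2l //; lra.
have rk : r ^+ 2 <= (T ^+ 2 + pi ^+ 2) * (k.+1%:R ^+ 2)^-1.
  rewrite r2; apply: ler_pM.
  - by lra.
  - by rewrite invr_ge0 ltW.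
  - by lra.
  rewrite lef_pV2 ?posrE ?exprn_gt0 ?ltr0n // wE -natr1.
  have h1 : 1 <= pi ^+ 2 :> R by have := @pi_ge2 R; rewrite expr2; nra.
  have h2 : (k%:R + 1) ^+ 2 <= (2 * k%:R + 1) ^+ 2 :> R by nra.
  apply: (le_trans h2); apply: ler_wpDl => //.
  by rewrite ler_peMl // sqr_ge0.
rewrite -{1}(subnK n2) exprD -mulrA; apply: ler_pM => //.
- by rewrite exprn_ge0.
- by rewrite sqr_ge0.
- by rewrite lerXn2r ?nnegrE // tail_ratio_ge0.
Qed.

End Ratio.

Lemma sign_of_close (s u : R) : (s = 1 \/ s = -1) -> `|u + 2 * s| <= 1 -> s * u < 0.
Proof. by case=> ->; rewrite ler_norml => /andP[h1 h2]; lra. Qed.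

(** The hypothesis on [y0 x ^+ n] says that [n phi = j pi] modulo [2 pi], with [phi]
    the argument of [y0 x]. The contributions of the two nearest poles, [0] and
    [2 pi i], are conjugate and add up to [- 2 (-1) ^ j / |y0 x| ^ n]; for large
    [n], and [x] away from [0] and [1], this dominates the rest of the expansion. *)
Lemma p_real_sign T : exists n0, forall n x j, (n0 <= n)%N -> 0 < x < 1 ->
  `|ln ((1 - x) / x)| <= T ->
  y0 x ^+ n = (-1) ^+ j * (N (y0 x) ^+ n)%:C ->
  (-1) ^+ j * (P n).[x] < 0.
Proof.
pose S := T ^+ 2 + pi ^+ 2.
have S0 : 0 < S by rewrite ltr_wpDl ?sqr_ge0 ?pi2_gt0.
(* Once the [n - 2]-th power of the ratio is below [1 / (8 S)], the other poles
   contribute at most [1 / 2], in units of [1 / |y0 x| ^ n]. *)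
have e8 : 0 < (8 * S)^-1 by rewrite invr_gt0 mulr_gt0.
have q1 : `|tail_ratio T| < 1.
  by rewrite ger0_norm ?tail_ratio_ge0 ?tail_ratio_lt1.
have := cvg_expr q1 => /cvgrPdist_le/(_ _ e8)[n0 _ H].
exists (n0 + 2)%N => n x j nn0 x01 tT yn.
have n2 : (2 <= n)%N by lia.
have {H} : tail_ratio T ^+ (n - 2) <= (8 * S)^-1.
  have := H (n - 2)%N; rewrite /= sub0r normrN => h; apply: le_trans (h _).
    exact: ler_norm.
  by lia.
set Q := tail_ratio T ^+ (n - 2) => Qle.
have Q0 : 0 <= Q by rewrite exprn_ge0 ?tail_ratio_ge0.
have yE := y0E x01; set t := ln _ in tT yE.
set y := y0 x in yn yE *.
have iy : complex.Im y = pi by [].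
have Ny : 0 < N y.
  by have [+ _] := normc_shift 0 iy; rewrite mulr0n addr0; apply: lt_le_trans.
set D := N y ^+ n; have D0 : 0 < D by rewrite exprn_gt0.
have sgn : (-1) ^+ j = 1 :> R \/ (-1) ^+ j = -1 :> R.
  by rewrite -signr_odd; case: odd; [right|left]; rewrite ?expr1 ?expr0.
have s2 : (-1) ^+ j * (-1) ^+ j = 1 :> R by rewrite -expr2 sqrr_sign.
rewrite -(pmulr_rlt0 _ D0) mulrCA; apply: sign_of_close => //.
have e2 : 0 < (2 * D)^-1 by rewrite invr_gt0 mulr_gt0.
have [m0 /(_ m0 (leqnn m0))] := Phi_expansion n2 iy e2.
rewrite (Phi_y0 n x01) -(prednK (expn_gt0 2 m0 : (0 < 2 ^ m0)%N)).
rewrite big_ord_recl mulr0n addr0 mulr1n.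
have signV : ((-1) ^+ j * D%:C)^-1 = ((-1) ^+ j * D^-1)%:C :> R[i].
  rewrite -(rmorphN1 (real_complex R)) -rmorphXn -rmorphM -fmorphV invfM.
  by rewrite invr_sign.
have -> : y ^- n = ((-1) ^+ j * D^-1)%:C by rewrite yn signV.
have -> : y - two_pi_i R = conjc y.
  rewrite yE /two_pi_i; apply/eqP; rewrite eq_complex /= subr0 eqxx /=.
  by apply/eqP; ring.
have -> : (conjc y) ^- n = ((-1) ^+ j * D^-1)%:C.
  rewrite -signV -rmorphXn yn rmorphM rmorphXn rmorphN1; congr ((_ * _)^-1).
  exact: conjc_real.
set rest := \sum_(k < _) _ => h.
have hrest : D * N rest <= 1 / 2.
  apply: (@le_trans _ _ (D * \sum_(0 <= k < (2 ^ m0).-1)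
     2 * (Q * S / D) * (k.+1%:R ^+ 2)^-1)).
    rewrite ler_wpM2l ?(ltW D0) //; apply: (le_trans (normc_sum _ _ _)).
    rewrite big_mkord; apply: ler_sum => k _; rewrite ?lift0.
    have [h1 h2] := normc_shift_sqr t k.+1; rewrite -yE in h1 h2.
    have b (w : R[i]) : N w ^+ 2 = t ^+ 2 + pi ^+ 2 * (2 * k.+1%:R + 1) ^+ 2 ->
        N (w ^- n) <= Q * S / D * (k.+1%:R ^+ 2)^-1.
      move=> wE; have := @ratioX_le T t n k.+1 w n2 isT tT wE.
      rewrite -yE -/D -/Q -/S mulrC -ler_pdivlMr // => hw.
      apply: (le_trans hw); rewrite mulrAC ler_wpM2l //.
        by rewrite !mulr_ge0 // ?(ltW S0) ?invr_ge0 ?(ltW D0).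
      rewrite lef_pV2 ?posrE ?exprn_gt0 ?ltr0n //.
      by rewrite lerXn2r ?nnegrE ?ler_nat.
    apply: (le_trans (le_normcD _ _)).
    apply: (le_trans (lerD (b _ h1) (b _ h2))).
    by rewrite le_eqVlt; apply/orP; left; apply/eqP; ring.
  rewrite -mulr_sumr; have := sum_inv_sqr_le R (2 ^ m0).-1.
  set sm := \sum_(_ <= _ < _) _ => hs.
  have sm2 : sm <= 2.
    by apply: (le_trans hs); rewrite gerBl divr_ge0.
  have -> : D * (2 * (Q * S / D) * sm) = 2 * (Q * S) * sm.
    by field; rewrite lt0r_neq0.
  have QS : Q * S <= 1 / 8.
    by rewrite -ler_pdivlMr // div1r -invfM.
  have QS0 : 0 <= Q * S by rewrite mulr_ge0 // ltW.
  by nra.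
have -> : D * (P n).[x] + 2 * (-1) ^+ j =
    D * ((P n).[x] + 2 * ((-1) ^+ j * D^-1)).
  by field; rewrite lt0r_neq0.
rewrite normrM (gtr0_norm D0) -normc_real.
set p := (P n).[x] in h *; set c := (-1) ^+ j * D^-1 in h *.
have -> : (p + 2 * c)%:C = (p%:C + (c%:C + c%:C + rest)) - rest.
  by rewrite rmorphD rmorphM rmorph_nat /=; ring.
apply: (@le_trans _ _ (D * ((2 * D)^-1 + N rest))).
  rewrite ler_wpM2l ?(ltW D0) //; apply: (le_trans (le_normcD _ _)).
  by rewrite normcN lerD2r.
rewrite mulrDr; have -> : D * (2 * D)^-1 = 1 / 2.
  by field; rewrite lt0r_neq0.
by lra.
Qed.

End Sign.

(** * Counting the zeros *)

Section Quantile.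
Variable R : realType.
Local Notation P n := (p_real R n).
Local Notation N := (@Normc.normc R).
Implicit Types x u : R.

(** The argument of [y0 x] divided by [pi]; [rho] is its derivative. *)
Definition cdf x : R := 1 / 2 - atan (ln ((1 - x) / x) / pi) / pi.

(** The inverse function of [cdf]. *)
Definition quantile u : R := (1 + expR (pi * tan (pi * (1 / 2 - u))))^-1.

Lemma quantile_itv u : 0 < quantile u < 1.
Proof.
have e0 := expR_gt0 (pi * tan (pi * (1 / 2 - u))).
rewrite /quantile; apply/andP; split; first by rewrite invr_gt0; lra.
by rewrite invf_lt1; lra.
Qed.

Lemma logit_quantile u :
  ln ((1 - quantile u) / quantile u) = pi * tan (pi * (1 / 2 - u)).
Proof.
have e0 := expR_gt0 (pi * tan (pi * (1 / 2 - u))).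
rewrite -[RHS]expRK; congr ln; rewrite /quantile.
by move: (expR _) e0 => e e0; field; lra.
Qed.

Lemma angle_itv u : 0 < u < 1 -> - (pi / 2) < pi * (1 / 2 - u) < pi / 2.
Proof. by move=> /andP[u0 u1]; have := @pi_gt0 R; nra. Qed.

Lemma quantileK u : 0 < u < 1 -> cdf (quantile u) = u.
Proof.
move=> u01; have p0 := @pi_gt0 R; have pn : pi != 0 :> R by rewrite gt_eqF.
rewrite /cdf logit_quantile; set th := pi * (_ - u).
have -> : pi * tan th / pi = tan th by rewrite mulrAC divff ?mul1r.
rewrite tanK /th.
  by move: pi pn => p pn; field; rewrite pn.
by rewrite in_itv /= angle_itv.
Qed.

Lemma logit_lt x y : 0 < x -> x < y -> y < 1 ->
  ln ((1 - y) / y) < ln ((1 - x) / x).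
Proof.
move=> x0 xy y1; have y0' : 0 < y := lt_trans x0 xy.
have x1 := lt_trans xy y1.
rewrite ltr_ln ?posrE ?divr_gt0 ?subr_gt0 //.
rewrite ltr_pdivrMr // mulrAC ltr_pdivlMr //.
by nra.
Qed.

Lemma cdf_lt x y : 0 < x -> x < y -> y < 1 -> cdf x < cdf y.
Proof.
move=> x0 xy y1; have p0 := @pi_gt0 R.
rewrite /cdf ltrD2l ltrN2 ltr_pM2r ?invr_gt0 //.
by apply: lt_atan; rewrite ltr_pM2r ?invr_gt0 // logit_lt.
Qed.

Lemma cdf_itv x : 0 < cdf x < 1.
Proof.
have p0 := @pi_gt0 R; rewrite /cdf; set a := atan _.
have h1 : a < pi / 2 := atan_ltpi2 _; have h2 : - (pi / 2) < a := atan_gtNpi2 _.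
have : a / pi < 1 / 2 by rewrite ltr_pdivrMr //; lra.
have : - (1 / 2) < a / pi by rewrite ltr_pdivlMr //; lra.
by lra.
Qed.

Lemma cdf_lt_mono x y : 0 < x < 1 -> 0 < y < 1 -> cdf x < cdf y -> x < y.
Proof.
move=> /andP[x0 x1] /andP[y0' y1]; case: (ltgtP x y) => // [yx|->].
  by have := cdf_lt y0' yx x1; lra.
by rewrite ltxx.
Qed.

(** At the quantile [j / n], the [n]-th power of [y0] is real, of sign
    [(-1) ^ j]. *)
Lemma y0_quantileX n j : (0 < j < n)%N ->
  let y := y0 (quantile (j%:R / n%:R)) in
  y ^+ n = (-1) ^+ j * (N y ^+ n)%:C.
Proof.
move=> /andP[j0 jn] y; rewrite {}/y; set u := j%:R / n%:R.
have n0 : (0 : R) < n%:R by rewrite ltr0n; lia.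
have u01 : 0 < u < 1.
  by rewrite /u divr_gt0 ?n0 ?ltr0n //= ltr_pdivrMr // mul1r ltr_nat.
rewrite y0E ?quantile_itv // logit_quantile.
have := angle_itv u01; set th := pi * (1 / 2 - u) => hth.
have c0 : 0 < cos th by exact: cos_gt0_pihalf.
have p0 := @pi_gt0 R.
pose r := pi / cos th; have r0 : 0 < r by rewrite divr_gt0.
have thE : th = - (pi * u - pi / 2) by rewrite /th; ring.
have -> : (pi * tan th) +i* pi = r%:C * cexp (0 +i* (pi * u)).
  apply/eqP; rewrite eq_complex /= expR0 !mul1r !mul0r subr0 addr0.
  have -> : cos (pi * u) = sin th by rewrite thE sinN sinBpihalf opprK.
  have -> : sin (pi * u) = cos th by rewrite thE cosN cosBpihalf.
  by rewrite /r /tan; apply/andP; split; apply/eqP; field; rewrite lt0r_neq0.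
have Nc (b : R) : N (cexp (0 +i* b)) = 1.
  by rewrite /= expR0 !mul1r cos2Dsin2 sqrtr1.
rewrite Normc.normcM Nc mulr1 normc_real gtr0_norm // exprMn -cexpMn.
have -> : (0 +i* (pi * u)) *+ n = (0 +i* pi) *+ j :> R[i].
  have im (b : R) k : (0 +i* b) *+ k = 0 +i* (b * k%:R) :> R[i].
    elim: k => [|k IHk]; first by rewrite mulr0n mulr0.
    rewrite mulrS IHk; apply/eqP; rewrite eq_complex /= addr0 eqxx /=.
    by rewrite -natr1; apply/eqP; ring.
  by rewrite !im /u; congr (_ +i* _); field; rewrite lt0r_neq0.
by rewrite cexpMn cexp_ipi mulrC rmorphXn.
Qed.

(** At least [n (B - A) - 2] multiples of [1 / n] lie strictly between [A] and
    [B], and [L + 1] of them delimit [L] intervals. *)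
Lemma grid_between (A B : R) n : 0 <= A -> (0 < n)%N ->
  exists j0 L : nat, n%:R * (B - A) - 3 <= L%:R /\
    forall i, (i <= L)%N -> (0 < L)%N -> A < (j0 + i)%N%:R / n%:R < B.
Proof.
move=> A0 npos; have n0 : (0 : R) < n%:R by rewrite ltr0n.
have [j0 j0l j0u] : exists2 j0 : nat, n%:R * A < j0%:R & j0%:R <= n%:R * A + 1.
  exists (Num.truncn (n%:R * A)).+1; first exact: truncnS_gt.
  by rewrite -natr1 lerD2r truncn_le mulr_ge0 // ltW.
exists j0; have [v3|v3] := leP 3 (n%:R * (B - A)); last first.
  exists 0%N; split => [|i _]; last by rewrite ltnn.
  by rewrite subr_le0 ltW.
have := truncnS_gt (n%:R * (B - A)); rewrite -natr1.
have : (Num.truncn (n%:R * (B - A)))%:R <= n%:R * (B - A).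
  by rewrite truncn_le; lra.
move: (Num.truncn _) => k h1 h2.
have k2 : (2 <= k)%N by rewrite -(ler_nat R); lra.
exists (k - 2)%N; rewrite natrB //; split; first by lra.
move=> i; rewrite -(ler_nat R) natrB // => ik _.
rewrite ltr_pdivlMr // ltr_pdivrMr // natrD.
by have := ler0n R i; lra.
Qed.

Lemma alternating_zeros (p : {poly R}) (X : nat -> R) j0 L :
  (forall i, (i < L)%N -> X i < X i.+1) ->
  (forall i, (i <= L)%N -> (-1) ^+ (j0 + i) * p.[X i] < 0) ->
  exists s : seq R, [/\ uniq s, size s = L &
    forall z, z \in s -> X 0%N < z < X L /\ root p z].
Proof.
move=> XS Xs.
have Xle i k : (i <= k)%N -> (k <= L)%N -> X i <= X k.
  elim: k => [|k IHk]; first by rewrite leqn0 => /eqP ->.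
  rewrite leq_eqVlt => /orP[/eqP -> //|ik kL].
  by rewrite (le_trans (IHk ik (ltnW kL))) // ltW // XS.
have zex i : exists z, (i < L)%N -> X i < z < X i.+1 /\ root p z.
  case: (ltnP i L) => [iL|_]; last by exists 0.
  have [|z zin zr] := @polyrcf.poly_ivtoo R p _ _ (ltW (XS i iL)).
    have := Xs i (ltnW iL); have := Xs i.+1 iL.
    rewrite addnS exprS mulN1r mulNr oppr_lt0.
    rewrite -signr_odd; case: odd; rewrite ?expr0 ?expr1 ?mulN1r ?mul1r.
      by rewrite oppr_gt0 oppr_lt0 => *; rewrite pmulr_rlt0.
    by move=> *; rewrite nmulr_rlt0.
  by exists z => _; split => //; rewrite in_itv /= in zin.
have [z zP] := choice zex.
have lt_z i k : (i < k)%N -> (k < L)%N -> z i < z k.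
  move=> ik kL; have [/andP[_ h1] _] := zP i (ltn_trans ik kL).
  have [/andP[h2 _] _] := zP k kL; apply: lt_trans h1 _.
  by apply: le_lt_trans h2; rewrite Xle // ltnW.
exists [seq z i | i <- iota 0 L]; split.
- rewrite map_inj_in_uniq ?iota_uniq // => i k; rewrite !mem_iota !add0n /=.
  move=> iL kL e; apply/eqP; case: ltngtP => // h.
    by have := lt_z _ _ h kL; rewrite e ltxx.
  by have := lt_z _ _ h iL; rewrite e ltxx.
- by rewrite size_map size_iota.
- move=> _ /mapP[i + ->]; rewrite mem_iota add0n /= => iL.
  have [/andP[h1 h2] ->] := zP i iL; split => //.
  rewrite (le_lt_trans _ h1) ?Xle //; last exact: ltnW.
  by rewrite (lt_le_trans h2) ?Xle.
Qed.

(** The polynomial changes sign between the quantiles of consecutive multiples of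
    [1 / n]. *)
Lemma zeros_between a b : 0 < a -> a < b -> b < 1 -> exists n0, forall n,
  (n0 <= n)%N -> exists s : seq R, [/\ uniq s,
    forall z, z \in s -> a < z < b /\ root (P n) z &
    n%:R * (cdf b - cdf a) - 3 <= (size s)%:R].
Proof.
move=> a0 ab b1; pose T := `|ln ((1 - a) / a)| + `|ln ((1 - b) / b)|.
have [n0 n0P] := p_real_sign T; exists (maxn n0 1) => n.
rewrite geq_max => /andP[nn0 npos].
have n0' : (0 : R) < n%:R by rewrite ltr0n.
have /andP[A0 _] := cdf_itv a; have /andP[_ B1] := cdf_itv b.
have [j0 [L [Ll uB]]] := grid_between (cdf b) (ltW A0) npos.
have [L0|L0] := posnP L.
  by exists [::]; split => //; move: Ll; rewrite L0.
pose u i : R := (j0 + i)%N%:R / n%:R.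
have u01 i : (i <= L)%N -> 0 < u i < 1.
  move=> iL; have /andP[h1 h2] := uB i iL L0.
  by rewrite (lt_trans A0 h1) (lt_trans h2 B1).
have a01 : 0 < a < 1 by rewrite a0 (lt_trans ab b1).
have b01 : 0 < b < 1 by rewrite b1 (lt_trans a0 ab).
have Xab i : (i <= L)%N -> a < quantile (u i) < b.
  move=> iL; have /andP[h1 h2] := uB i iL L0; apply/andP; split.
    by apply: cdf_lt_mono => //; rewrite ?quantile_itv // quantileK ?u01.
  by apply: cdf_lt_mono => //; rewrite ?quantile_itv // quantileK ?u01.
have [|i iL|s [us sL sP]] := @alternating_zeros (P n) (quantile \o u) j0 L.
- move=> i iL; apply: cdf_lt_mono; rewrite ?quantile_itv //.
  rewrite !quantileK ?u01 ?(ltnW iL) //.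
  by rewrite ltr_pM2r ?invr_gt0 // ltr_nat addnS.
- have /andP[h1 h2] := Xab i iL.
  have /andP[x0 x1] := quantile_itv (u i).
  apply: n0P => //; first exact: quantile_itv.
    have k1 := logit_lt a0 h1 x1; have k2 := logit_lt x0 h2 b1.
    rewrite ler_norml /T; apply/andP; split.
      have k3 := ler_norm (- ln ((1 - b) / b)); rewrite normrN in k3.
      by have := normr_ge0 (ln ((1 - a) / a)); lra.
    have k3 := ler_norm (ln ((1 - a) / a)).
    by have := normr_ge0 (ln ((1 - b) / b)); lra.
  apply: y0_quantileX; have /andP[v0 v1] := u01 i iL.
  move: v1; rewrite /u ltr_pdivrMr // mul1r ltr_nat => ->; rewrite andbT.
  by rewrite -(ltr_nat R) -(pmulr_lgt0 _ (_ : 0 < n%:R^-1)) ?invr_gt0.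
exists s; split => //; last by rewrite sL.
move=> z /sP[/andP[h1 h2] rz]; split => //.
have /andP[h3 _] := Xab 0%N (leq0n _); have /andP[_ h4] := Xab L (leqnn _).
by rewrite (lt_trans h3 h1) (lt_trans h2 h4).
Qed.

End Quantile.

(** * The limit density *)

Section Density.
Variable R : realType.

Let logit : R -> R := (@ln R \o (cst 1 - id)) - @ln R.

Let F : R -> R := cst (1 / 2) - pi^-1 *: (@atan R \o (pi^-1 *: logit)).

Let rho' (x : R) : R := (x * (1 - x) * (pi ^+ 2 + logit x ^+ 2))^-1.

Let logitE x : 0 < x < 1 -> ln ((1 - x) / x) = logit x.
Proof. by move=> /andP[x0 x1]; rewrite ln_div ?posrE ?subr_gt0. Qed.

Let cdfE x : 0 < x < 1 -> cdf x = F x.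
Proof.
move=> x01; rewrite /cdf logitE //.
have -> : F x = 1 / 2 - pi^-1 * atan (pi^-1 * logit x) by [].
by rewrite (mulrC _ (logit x)) (mulrC _ (atan _)).
Qed.

Let rhoE x : 0 < x < 1 -> rho x = rho' x.
Proof.
by move=> x01; rewrite /rho /rho' normc_sqr y0E // logitE // (addrC (pi ^+ 2)).
Qed.

Let is_derive_logit (x : R) : 0 < x < 1 -> is_derive x 1 logit (- (x * (1 - x))^-1).
Proof.
move=> /andP[x0 x1].
have x1' : 0 < 1 - x by rewrite subr_gt0.
have d1 : is_derive x 1 (cst 1 - id : R -> R) (0 - 1) by apply: is_deriveB.
have d2 : is_derive x 1 (@ln R \o (cst 1 - id)) ((1 - x)^-1 * (0 - 1)).
  by apply: is_derive1_comp; apply: is_derive1_ln.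
have d3 := is_derive1_ln x0.
have -> : - (x * (1 - x))^-1 = (1 - x)^-1 * (0 - 1) - x^-1.
  by field; rewrite !lt0r_neq0.
exact: is_deriveB.
Qed.

Let is_derive_F (x : R) : 0 < x < 1 -> is_derive x 1 F (rho' x).
Proof.
move=> x01; have d1 := is_derive_logit x01.
have d2 := is_deriveZ (pi^-1) d1.
have d3 := is_derive1_comp (is_derive1_atan ((pi^-1 *: logit) x)) d2.
have d4 := is_deriveZ (pi^-1) d3.
suff -> : rho' x = 0 - pi^-1 *: ((1 + ((pi^-1 *: logit) x) ^+ 2)^-1 *
    (pi^-1 *: - (x * (1 - x))^-1)) by exact: is_deriveB.
rewrite sub0r /rho' (_ : (pi^-1 *: logit) x = pi^-1 * logit x) //.
have sc (k l : R) : k *: l = k * l by [].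
rewrite !sc.
have p0 : pi != 0 :> R by rewrite gt_eqF ?pi_gt0.
have q0 : pi ^+ 2 + logit x ^+ 2 != 0.
  by rewrite gt_eqF // ltr_wpDr ?sqr_ge0 // exprn_gt0 ?pi_gt0.
move/andP: x01 => [x0 x1].
move: pi (logit x) p0 q0 => p l p0 q0.
have h : 1 + (p^-1 * l) ^+ 2 = (p ^+ 2 + l ^+ 2) / p ^+ 2 by field.
rewrite h; field; rewrite p0 q0 /=.
by rewrite !lt0r_neq0 ?subr_gt0.
Qed.

Let rho'_continuous x : 0 < x < 1 -> {for x, continuous rho'}.
Proof.
move=> x01; have d1 := is_derive_logit x01.
have cl : {for x, continuous logit}.
  by apply: differentiable_continuous; apply/derivable1_diffP; case: d1.
have q0 : pi ^+ 2 + logit x ^+ 2 != 0.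
  by rewrite gt_eqF // ltr_wpDr ?sqr_ge0 // exprn_gt0 ?pi_gt0.
move/andP: x01 => [x0 x1].
have q : x * (1 - x) * (pi ^+ 2 + logit x ^+ 2) != 0.
  by rewrite !mulf_neq0 // lt0r_neq0 // subr_gt0.
apply: (cvgV q); apply: cvgM; first apply: cvgM.
- exact: cvg_id.
- by apply: cvgB; [exact: cvg_cst|exact: cvg_id].
apply: cvgD; first exact: cvg_cst.
by rewrite expr2; apply: cvgM.
Qed.

Lemma integral_rho (a b : R) : 0 < a -> a < b -> b < 1 ->
  (\int[lebesgue_measure]_(x in `[a, b]) rho x)%R = cdf b - cdf a.
Proof.
move=> a0 ab b1.
have in01 x : a <= x -> x <= b -> 0 < x < 1.
  by move=> ax xb; rewrite (lt_le_trans a0 ax) (le_lt_trans xb b1).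
transitivity (\int[lebesgue_measure]_(x in `[a, b]) rho' x)%R.
  apply: eq_Rintegral => x; rewrite inE /= in_itv /= => /andP[ax xb].
  by rewrite rhoE ?in01.
rewrite /Rintegral (@continuous_FTC2 R rho' F) //.
- by rewrite /= !cdfE ?in01 // ltW.
- apply: continuous_in_subspaceT => x; rewrite inE /= in_itv /= => /andP[ax xb].
  exact/rho'_continuous/in01.
- have dF x : a <= x -> x <= b -> derivable F x 1.
    by move=> ax xb; have [] := is_derive_F (in01 x ax xb).
  have cF x : a <= x -> x <= b -> {for x, continuous F}.
    move=> ax xb; apply: differentiable_continuous; apply/derivable1_diffP.
    exact: dF.
  split.
  + by move=> x; rewrite in_itv /= => /andP[ax xb]; apply: dF; exact: ltW.
  + by apply: cvg_at_right_filter; apply: cF; rewrite ?lexx ?(ltW ab).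
  + by apply: cvg_at_left_filter; apply: cF; rewrite ?lexx ?(ltW ab).
- move=> x; rewrite in_itv /= => /andP[ax xb].
  rewrite derive1E; have d := is_derive_F (in01 x (ltW ax) (ltW xb)).
  by rewrite derive_val.
Qed.

End Density.

Section Counting.
Variable R : realType.
Local Notation P n := (p_real R n).

Lemma card_zeros_itv n (f : nat -> R) (a b : R) : (0 < n)%N -> zero_list n f ->
  #|` fset_set [set x : R | x \in `[a, b] /\ (P n).[x] = 0]| =
  size [seq z <- zeros n f | a <= z <= b].
Proof.
move=> n0 zf; set s := [seq z <- _ | _].
have -> : [set x : R | x \in `[a, b] /\ (P n).[x] = 0] = [set` [fset z in s]%fset].
  apply/seteqP; split => x /=.
    move=> [xab /eqP x0]; rewrite !inE mem_filter.
    move: xab; rewrite in_itv /= => ->.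
    by rewrite -mem_zeros.
  rewrite !inE mem_filter -mem_zeros // => /andP[xab /eqP x0].
  by split.
rewrite set_fsetK card_fseq undup_id // filter_uniq //.
exact: uniq_zeros zf.
Qed.

(** The lower bound of [zeros_between] on [(a, b)] is half of the claim. For the
    other half, it is applied to two intervals [(a', a)] and [(b, b')] that leave
    out a mass at most [e / 2]: their zeros are not among those counted here, and
    there are only [n] zeros in total. *)
Lemma zeros_equidistributed (a b : R) : 0 < a -> a < b -> b < 1 ->
  (#|` fset_set [set x : R | x \in `[a, b] /\ (P n).[x] = 0]|%:R
        / n%:R : R) @[n --> \oo] --> cdf b - cdf a.
Proof.
move=> a0 ab b1; have [xi xiP] := zero_list_exists R.
have zf n : (0 < n)%N -> zero_list n (xi n) by move=> /xiP[].
have b0 := lt_trans a0 ab; have a1 := lt_trans ab b1.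
have /andP[A0 _] := cdf_itv a; have /andP[_ B1] := cdf_itv b.
set A := cdf a in A0 *; set B := cdf b in B1 *.
apply/cvgrPdist_le => e e0.
pose da := Num.min (e / 4) (A / 2); pose db := Num.min (e / 4) ((1 - B) / 2).
have da0 : 0 < da by rewrite lt_min; apply/andP; split; lra.
have db0 : 0 < db by rewrite lt_min; apply/andP; split; lra.
have da1 : da <= e / 4 by rewrite ge_min lexx.
have db1 : db <= e / 4 by rewrite ge_min lexx.
have daA : da < A.
  by apply: (@le_lt_trans _ _ (A / 2)); [rewrite ge_min lexx orbT | lra].
have dbB : B < 1 - db.
  have : db <= (1 - B) / 2 by rewrite ge_min lexx orbT.
  by lra.
have AB : A < B := cdf_lt a0 ab b1.
have a01 : 0 < a < 1 by rewrite a0.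
have b01 : 0 < b < 1 by rewrite b0.
pose a' := quantile da; pose b' := quantile (1 - db).
have ca' : cdf a' = da by rewrite quantileK //; lra.
have cb' : cdf b' = 1 - db by rewrite quantileK //; lra.
have aa : a' < a.
  by apply: cdf_lt_mono; rewrite ?quantile_itv // ca'.
have bb : b < b'.
  by apply: cdf_lt_mono; rewrite ?quantile_itv // cb'.
have /andP[a'0 _] := quantile_itv da; have /andP[_ b'1] := quantile_itv (1 - db).
have [n1 H1] := zeros_between a'0 aa a1.
have [n2 H2] := zeros_between a0 ab b1.
have [n3 H3] := zeros_between b0 bb b'1.
(* The two outer intervals lose at most [3] zeros each, and [6 / n <= e / 2]. *)
pose n4 := Num.bound (12 / e).
near=> n.
have [nn1 nn2 nn3 nn4] : [/\ n1 <= n, n2 <= n, n3 <= n & n4 < n]%N.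
  by split; near: n; exact: nbhs_infty_ge || exact: nbhs_infty_gt.
have npos : (0 < n)%N by apply: leq_ltn_trans nn4.
have n0 : (0 : R) < n%:R by rewrite ltr0n.
have zfn := zf n npos; rewrite (card_zeros_itv _ _ npos zfn).
set s := [seq z <- _ | _].
have us : uniq s by apply: filter_uniq; exact: uniq_zeros zfn.
have [s1 [us1 s1P l1]] := H1 n nn1.
have [s2 [us2 s2P l2]] := H2 n nn2.
have [s3 [us3 s3P l3]] := H3 n nn3.
have lo : (size s2 <= size s)%N.
  apply: uniq_leq_size => // z /s2P[/andP[h1 h2] rz].
  by rewrite mem_filter !ltW //= -(mem_zeros npos zfn).
have up : (size s1 + size s + size s3 <= n)%N.
  rewrite -(size_zeros n (xi n)) -!size_cat; apply: uniq_leq_size.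
    rewrite !cat_uniq us1 us us3 /= !andbT; apply/andP; split.
      apply/hasPn => z; rewrite mem_filter => /andP[/andP[az _] _].
      by apply/negP => /s1P[/andP[_ za] _]; lra.
    apply/hasPn => z /s3P[/andP[bz _] _]; rewrite mem_cat negb_or; apply/andP; split.
      by apply/negP => /s1P[/andP[_ za] _]; lra.
    by rewrite mem_filter; apply/negP => /andP[/andP[_ zb] _]; lra.
  move=> z; rewrite !mem_cat -(mem_zeros npos zfn) => /orP[/orP[]|].
  - by move=> /s1P[].
  - by rewrite mem_filter -(mem_zeros npos zfn) => /andP[].
  - by move=> /s3P[].
have ne : 12 <= e * n%:R.
  rewrite -ler_pdivrMl // mulrC; apply: ltW.
  apply: lt_trans (archi_boundP _) _; first by rewrite divr_ge0 // ltW.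
  by rewrite ltr_nat.
rewrite ca' -/A in l1; rewrite -/A -/B in l2; rewrite cb' -/B in l3.
have lo' : (size s2)%:R <= (size s)%:R :> R by rewrite ler_nat.
have up' : (size s1)%:R + (size s)%:R + (size s3)%:R <= n%:R :> R.
  by rewrite -!natrD ler_nat.
rewrite ler_norml; apply/andP; split.
  rewrite lerBrDl -lerBrDr opprK ler_pdivrMr //.
  have : n%:R * da <= n%:R * (e / 4) by rewrite ler_pM2l.
  have : n%:R * db <= n%:R * (e / 4) by rewrite ler_pM2l.
  by lra.
rewrite lerBlDr -lerBlDl ler_pdivlMr //.
by lra.
Unshelve. all: by end_near. Qed.

End Counting.

Theorem mainTheorem6 (R : realType) :
  (* (1) *)
  [/\ p_ 1 = 'X,
      p_ 2 = 'X * (1 - 'X)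
    & forall n : nat, (2 <= n)%N -> p_ n \Po (1 - 'X) = (-1) ^+ n *: p_ n] /\
  (* (2): xi n j is the j-th zero of p_n, 1 <= j <= n *)
  (exists xi : nat -> nat -> R,
    forall n : nat, (1 <= n)%N ->
      (forall j : nat, (1 <= j <= n)%N ->
         0 <= xi n j <= 1 /\ mup (xi n j) (p_real R n) = 1%N) /\
      (forall z : R, root (p_real R n) z <->
         exists2 j : nat, (1 <= j <= n)%N & z = xi n j) /\
      (forall j k : nat, (1 <= j)%N -> (j < k)%N -> (k <= n)%N ->
         xi n j < xi n k) /\
      xi n 1%N = 0 /\
      ((2 <= n)%N -> xi n n = 1) /\
      (forall j : nat, (1 <= j <= n.-1)%N ->
         xi n j < xi n.+1 j.+1 < xi n j.+1)) /\
  (* (3) *)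
  (forall a b : R, 0 < a -> a < b -> b < 1 ->
     (#|` fset_set [set x : R | x \in `[a, b] /\ (p_real R n).[x] = 0]|%:R
        / n%:R : R) @[n --> \oo]
       --> (\int[lebesgue_measure]_(x in `[a, b]) rho x)%R) /\
  (* (4) *)
  (forall (x : R) (n : nat), 0 < x < 1 -> (2 <= n)%N ->
     ((p_real R n).[x])%:C =
       - 1 / two_pi_i R ^+ n *
       (hurwitz_zeta n (y0 x / two_pi_i R) +
        (-1) ^+ n * hurwitz_zeta n (1 - y0 x / two_pi_i R))).
Proof.
split; first by split; [exact: p_1 | exact: p_2 | exact: p_sym].
split.
  have [xi xiP] := zero_list_exists R; exists xi => n n0.
  have [zf il] := xiP n n0; have [rf inc f1 fn] := zf.
  have memz j : (1 <= j <= n)%N -> xi n j \in zeros n (xi n).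
    by move=> jn; apply: map_f; rewrite mem_iota; lia.
  split.
    move=> j jn; rewrite (zero_list_ge0 zf jn) (zero_list_le1 zf jn).
    by split => //; apply: (mup_zeros n0 zf); exact: memz.
  split; last by [].
  move=> z; rewrite (mem_zeros n0 zf); split; last by move=> [j /memz + ->].
  by move=> /mapP[j jn ->]; exists j => //; move: jn; rewrite mem_iota; lia.
split; last by move=> x n; exact: hurwitz_expansion.
move=> a b a0 ab b1; rewrite (integral_rho a0 ab b1).
exact: zeros_equidistributed.
Qed.
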